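(* The functor $I$ of idempotent probability measures, acting in the category of compacta (metrizable compact spaces) and their continuous mappings, is perfectly metrizable (with respect to the natural transformations $\eta_X: X\to I(X)$ and $\psi_X: I^2(X)\to I(X)$).
   Context: **Idempotent probability measures.** On $\mathbb{R}$ write $u\oplus v=\max\{u,v\}$ and $u\odot v=u+v$. For a compact Hausdorff space $X$ let $C(X)$ be the set of continuous functions $X\to\mathbb{R}$; on $C(X)$ put $\varphi\oplus\psi=\max\{\varphi,\psi\}$ (pointwise) and $\lambda\odot\varphi=\varphi+\lambda_X$, where $\lambda_X$ is the constant function with value $\lambda\in\mathbb{R}$. A functional $\mu:C(X)\to\mathbb{R}$ is an idempotent probability measure on $X$ if (1) $\mu(\lambda_X)=\lambda$ for all $\lambda\in\mathbb{R}$; (2) $\mu(\lambda\odot\varphi)=\mu(\varphi)+\lambda$ for all $\lambda\in\mathbb{R}$, $\varphi\in C(X)$; (3) $\mu(\varphi\oplus\psi)=\mu(\varphi)\oplus\mu(\psi)$ for all $\varphi,\psi\in C(X)$. The set $I(X)$ of all such $\mu$ carries the topology of pointwise convergence (subspace of $\mathbb{R}^{C(X)}$) and is compact Hausdorff. For continuous $f:X\to Y$ put $I(f)(\mu)(\varphi)=\mu(\varphi\circ f)$, $\mu\in I(X)$, $\varphi\in C(Y)$; this makes $I$ a covariant functor. Put $I^0(X)=X$, $I^n(X)=I(I^{n-1}(X))$. **The natural transformations.** $\eta_X:X\to I(X)$ is $\eta_X(x)=\delta_x$, where $\delta_x(\varphi)=\varphi(x)$. $\psi_X:I^2(X)\to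 I(X)$ is $\psi_X(M)(\varphi)=M(\overline{\varphi})$, where for $\varphi\in C(X)$ the function $\overline{\varphi}\in C(I(X))$ is $\overline{\varphi}(\mu)=\mu(\varphi)$. Write $\eta_{n,n+1}=\eta_{I^n(X)}:I^n(X)\to I^{n+1}(X)$. **Perfect metrizability.** Let $F$ be a functor on compacta with natural transformations $\eta:\mathrm{Id}\to F$ and $\psi:F^2\to F$. $F$ is *perfectly metrizable* if to every compactum $X$ and every metric $\rho$ on $X$ (compatible with the topology) one can assign a metric $\rho_F$ on $F(X)$ (compatible with its topology) such that the following hold, where $\rho_{F^n}$ on $F^n(X)$ denotes the metric obtained by iterating the assignment, i.e. $\rho_{F^{n+1}}=(\rho_{F^n})_F$: (P1) if $i:(X_1,\rho^1)\to(X_2,\rho^2)$ is an isometric embedding, then so is $F(i):(F(X_1),\rho^1_F)\to(F(X_2),\rho^2_F)$; (P2) $\eta_X:(X,\rho)\to(F(X),\rho_F)$ is an isometric embedding; (P3) $\mathrm{diam}(F(X),\rho_F)=\mathrm{diam}(X,\rho)$; (P4) for every continuous $f:(X_1,\rho^1)\to(X_2,\rho^2)$ the map $F^+(f):(F^+(X_1),\rho^1_+)\to(F^+(X_2),\rho^2_+)$ is uniformly continuous; here $F^+(X)$ is the direct limit (union) of the sequence of isometric embeddings $X\to F(X)\to F^2(X)\to\cdots$ with bonding maps $\eta_{F^n(X)}$, $\rho_+$ is the metric on $F^+(X)$ induced by the metrics $\rho_{F^n}$, and $F^+(f)$ is the map induced by the maps $F^n(f)$; (P5) $\psi_X:(F^2(X),\rho_{F^2})\to(F(X),\rho_F)$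 is non-expanding; (P6) for all $a\in F(X)$, $x_0\in X$ and $b\in\psi_X^{-1}(a)$ one has $\rho_F(a,\eta_X(x_0))=\rho_{F^2}(b,\eta_{F(X)}(\eta_X(x_0)))$; (P7) if $a\in F(X)$ and $\rho_F(a,\eta_X(X))\ge\varepsilon$, then $\rho_{F^2}(F(\eta_X)(a),\eta_{F(X)}(F(X)))\ge\varepsilon$, where the distance from a point to a set is the infimum of distances. (Properties P1–P3 define a metrizable functor, P1–P4 a uniformly metrizable one.) *)

(* Defs.v *)
From HB Require Import structures.
From mathcomp Require Import all_boot all_order all_algebra.
From mathcomp Require Import generic_quotient.
From mathcomp Require Import all_classical all_reals.
From mathcomp Require Import topology normedtype.
From mathcomp Require Import zify lra.

Set Implicit Arguments.
Unset Strict Implicit.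
Unset Printing Implicit Defensive.

Import Order.TTheory GRing.Theory Num.Theory.
Import numFieldNormedType.Exports.

Local Open Scope classical_set_scope.
Local Open Scope ring_scope.

(* The real line is an arbitrary R : realType. *)

Section Metrics.
Variable R : realType.

(* A metric on X compatible with the given topology of X.  Nonnegativity      *)
(* follows from the other axioms (see metric_ge0).                            *)
Record metric_on (X : topologicalType) := MetricOn {
  dist_of :> X -> X -> R;
  metric_xx : forall x, dist_of x x = 0;
  metric_eq0 : forall x y, dist_of x y = 0 -> x = y;
  metric_sym : forall x y, dist_of x y = dist_of y x;
  metric_triangle : forall y x z, dist_of x z <= dist_of x y + dist_of y z;
  metric_nbhs : forall x, nbhs x =
    filter_from [set e : R | 0 < e] (fun e => [set y | dist_of x y < e])
}.

Lemma metric_ge0 (X : topologicalType) (rho : metric_on X) x y : 0 <= rho x y.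
Proof.
have := metric_triangle rho y x x.
by rewrite metric_xx (metric_sym rho y x) -mulr2n pmulrn_lge0.
Qed.

Lemma metric_near (X : topologicalType) (rho : metric_on X) x (e : R) :
  0 < e -> \forall y \near x, rho x y < e.
Proof. by move=> e0; rewrite /prop_near1 (metric_nbhs rho); exists e. Qed.

Definition isometric (X Y : topologicalType) (rhoX : metric_on X)
  (rhoY : metric_on Y) (f : X -> Y) :=
  forall x x', rhoY (f x) (f x') = rhoX x x'.

Definition nonexpanding (X Y : topologicalType) (rhoX : metric_on X)
  (rhoY : metric_on Y) (f : X -> Y) :=
  forall x x', rhoY (f x) (f x') <= rhoX x x'.

(* The diameter of the empty space is sup set0 = 0. *)
Definition diam (X : topologicalType) (rho : metric_on X) : R :=
  sup [set rho p.1 p.2 | p in [set: X * X]].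

Definition dist_to (X : topologicalType) (rho : metric_on X) (a : X)
  (A : set X) : R := inf [set rho a x | x in A].

Lemma compact_metrizable (T : topologicalType) (p : nat -> T -> T -> R) :
  compact [set: T] ->
  (forall n x, p n x x = 0) ->
  (forall n x y, p n x y = p n y x) ->
  (forall n y x z, p n x z <= p n x y + p n y z) ->
  (forall n x (e : R), 0 < e -> \forall y \near x, p n x y < e) ->
  (forall x y, (forall n, p n x y = 0) -> x = y) ->
  inhabited (metric_on T).
Proof.
move=> cT pxx psym ptri pnear psep.
have p0 n x y : 0 <= p n x y.
  by have := ptri n y x x; rewrite pxx (psym n y x) -mulr2n pmulrn_lge0.
pose c n : R := n.+1%:R^-1.
have c0 n : 0 < c n by rewrite invr_gt0 ltr0n.
have c1 n : c n <= 1 by rewrite invf_le1 ?ler1n ?ltr0n.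
pose q n x y := Num.min (c n) (p n x y).
have q0 n x y : 0 <= q n x y by rewrite le_min (ltW (c0 n)) p0.
pose A x y := range (fun n => q n x y).
have supA x y : has_sup (A x y).
  split; first by exists (q 0%N x y), 0%N.
  by exists 1 => _ [n _ <-]; rewrite (le_trans _ (c1 n))// ge_min lexx.
pose d x y := sup (A x y).
have qd n x y : q n x y <= d x y.
  by apply: sup_upper_bound; [exact: supA|exists n].
have dub x y e : (forall n, q n x y <= e) -> d x y <= e.
  by move=> h; apply: ge_sup; [exact: (supA x y).1|move=> _ [n _ <-]].
have dxx x : d x x = 0.
  apply/eqP; rewrite eq_le; apply/andP; split.
    by apply: dub => n; rewrite /q pxx ge_min lexx orbT.
  exact: le_trans (q0 0%N x x) (qd _ _ _).
have dsep x y : d x y = 0 -> x = y.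
  move=> dxy; apply: psep => n; apply/eqP; rewrite eq_le p0 andbT.
  by have := qd n x y; rewrite dxy /q ge_min leNgt c0.
have dsym x y : d x y = d y x.
  rewrite /d /A; suff -> : (fun n => q n x y) = (fun n => q n y x) by [].
  by apply/funext => n; rewrite /q psym.
have dtri y x z : d x z <= d x y + d y z.
  apply: dub => n; apply: le_trans (lerD (qd n x y) (qd n y z)).
  rewrite {1}/q.
  have [a|a] := leP (c n) (p n x y).
    by rewrite {1}/q (min_l a) ge_min lerDl q0.
  have [b|b] := leP (c n) (p n y z).
    by rewrite {2}/q (min_l b) ge_min lerDr q0.
  by rewrite /q (min_r (ltW a)) (min_r (ltW b)) ge_min ptri orbT.
have dnear x (e : R) : 0 < e -> \forall y \near x, d x y < e.
  move=> e0; have e20 : 0 < e / 2 by rewrite divr_gt0.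
  have [N Ne] : exists N, c N < e / 2.
    exists (Num.truncn (e / 2)^-1); rewrite /c invf_plt ?posrE ?ltr0n//.
    exact: truncnS_gt.
  have near_all : nbhs x [set y | forall i : 'I_N, p i x y < e / 2].
    by apply: (@filter_forall _ _ (fun (i : 'I_N) y => p i x y < e / 2)) => i; exact: pnear.
  apply: filterS near_all => y h.
  apply: le_lt_trans (_ : e / 2 < e); last by rewrite ltr_pdivrMr// ltr_pMr// ltr1n.
  apply: dub => n; rewrite /q ge_min; have [nN|Nn] := ltnP n N.
    by rewrite (ltW (h (Ordinal nN))) orbT.
  rewrite (le_trans _ (ltW Ne))// /c lef_pV2 ?posrE ?ltr0n// ler_nat.
  by rewrite ltnS.
constructor; apply: (@MetricOn T d) => // x; apply/seteqP; split => U.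
  rewrite nbhsE => -[V [oV Vx] VU].
  have cV : compact (~` V).
    apply: (@subclosed_compact _ _ [set: T]) => //.
    by rewrite closedC.
  have /compact_near_coveringP nc := cV.
  have [] : \forall e \near (0:R)^'+, ~` V `<=` (fun y => e <= d x y).
    apply: nc => y nVy.
    have xy : x <> y by move=> xy; apply: nVy; rewrite -xy.
    have [n /eqP pn] : exists n, p n x y <> 0.
      by apply: contrapT => /forallNP h; apply: xy; apply: psep => n;
        exact: contrapT (h n).
    pose r := p n x y / 2.
    have r0 : 0 < r by rewrite divr_gt0// lt_neqAle p0 eq_sym pn.
    near=> y' e => /=.
    apply: le_trans (qd n x y').
    rewrite /q le_min; apply/andP; split.
      by near: e; exact: nbhs_right_le.
    apply: (@le_trans _ _ r); first by near: e; exact: nbhs_right_le.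
    have : p n x y <= p n x y' + r.
      apply: (le_trans (ptri n y' _ _)); rewrite lerD2l psym ltW//.
      by near: y'; exact: pnear.
    by rewrite -lerBlDr {1}(splitr (p n x y)) -/r addrK.
  move=> e /= e0 h; have e20 : 0 < e / 2 by rewrite divr_gt0.
  exists (e / 2) => // y /= dxy; apply: VU; apply: contrapT => Vy.
  have : e / 2 <= d x y.
    apply: h => //=; rewrite sub0r normrN gtr0_norm//.
    by rewrite ltr_pdivrMr// ltr_pMr// ltr1n.
  by rewrite leNgt dxy.
case=> e /= e0 eU; exact: filterS eU (dnear x e e0).
Unshelve. all: by end_near. Qed.
End Metrics.

Section Compacta.
Variable R : realType.

Record compactum := Compactum {
  space_of :> topologicalType;
  compactum_compact : compact [set: space_of];
  compactum_metrizable : inhabited (metric_on R space_of)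
}.

Record endofunctor := Endofunctor {
  fobj :> compactum -> compactum;
  fmap : forall X Y : compactum,
    continuousType X Y -> continuousType (fobj X) (fobj Y);
  fmap_id : forall X : compactum, fmap (idfun : continuousType X X) =1 idfun;
  fmap_comp : forall (X Y Z : compactum) (g : continuousType Y Z)
    (f : continuousType X Y),
    fmap (g \o f : continuousType X Z) =1 fmap g \o fmap f
}.

Definition id_functor : endofunctor :=
  @Endofunctor (fun X => X) (fun X Y f => f)
    (fun X x => erefl) (fun X Y Z g f x => erefl).

Lemma sqr_functor_id (F : endofunctor) (X : compactum) :
  fmap F (fmap F (idfun : continuousType X X) : continuousType (F X) (F X))
    =1 idfun.
Proof.
move=> x; have -> : fmap F (idfun : continuousType X X) = idfun :> continuousType _ _.
  by apply/continuousEP; exact: (@fmap_id F X).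
exact: fmap_id.
Qed.

Lemma sqr_functor_comp (F : endofunctor) (X Y Z : compactum)
    (g : continuousType Y Z) (f : continuousType X Y) :
  fmap F (fmap F (g \o f : continuousType X Z) : continuousType (F X) (F Z))
    =1 fmap F (fmap F g : continuousType (F Y) (F Z)) \o
       fmap F (fmap F f : continuousType (F X) (F Y)).
Proof.
move=> x; have -> : fmap F (g \o f : continuousType X Z) =
    (fmap F g \o fmap F f) :> continuousType (F X) (F Z).
  by apply/continuousEP; exact: fmap_comp.
exact: fmap_comp.
Qed.

Definition sqr_functor (F : endofunctor) : endofunctor :=
  @Endofunctor (fun X => F (F X)) (fun X Y f => fmap F (fmap F f))
    (@sqr_functor_id F) (@sqr_functor_comp F).

Record nat_trans (F G : endofunctor) := NatTrans {
  component :> forall X : compactum, continuousType (F X) (G X);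
  naturality : forall (X Y : compactum) (f : continuousType X Y),
    component Y \o fmap F f =1 fmap G f \o component X
}.

Section Iterates.
Variables (F : endofunctor) (eta : nat_trans id_functor F).

Fixpoint iter_obj (n : nat) (X : compactum) : compactum :=
  if n is n'.+1 then F (iter_obj n' X) else X.

Fixpoint iter_map (n : nat) (X Y : compactum) (f : continuousType X Y) :
    continuousType (iter_obj n X) (iter_obj n Y) :=
  match n with
  | 0%N => f
  | n'.+1 => fmap F (iter_map n' f)
  end.

(* A rule assigning to a metric on X a metric on F X; all metrics are         *)
(* compatible with the topologies by definition of metric_on.                 *)
Definition metric_lift := forall X : compactum, metric_on R X -> metric_on R (F X).

Fixpoint iter_metric (L : metric_lift) (n : nat) (X : compactum)
    (rho : metric_on R X) : metric_on R (iter_obj n X) :=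
  match n with
  | 0%N => rho
  | n'.+1 => L _ (iter_metric L n' rho)
  end.

(* F^+(X) is the direct limit of X -> F X -> F (F X) -> ..., i.e. the quotient*)
(* of the disjoint union of the F^n X in which a point is identified with its *)
(* images under the bonding maps eta.                                         *)
Definition stage (X : compactum) : Type := {n : nat & iter_obj n X}.

Definition bond (X : compactum) (p : stage X) : stage X :=
  let: existT n a := p in existT _ n.+1 (eta (iter_obj n X) a).

Definition same_germ (X : compactum) (p q : stage X) : bool :=
  `[< exists k l, iter k (@bond X) p = iter l (@bond X) q >].

Lemma same_germ_refl X : reflexive (@same_germ X).
Proof. by move=> p; apply/asboolP; exists 0%N, 0%N. Qed.

Lemma same_germ_sym X : symmetric (@same_germ X).
Proof.
by move=> p q; apply/asboolP/asboolP => -[k [l kl]]; exists l, k.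
Qed.

Lemma same_germ_trans X : transitive (@same_germ X).
Proof.
move=> q p r /asboolP[k [l pq]] /asboolP[k' [l' qr]]; apply/asboolP.
exists (k' + k)%N, (l + l')%N.
by rewrite iterD pq -iterD addnC iterD qr -iterD.
Qed.

Canonical same_germ_equiv X := EquivRel (@same_germ X)
  (@same_germ_refl X) (@same_germ_sym X) (@same_germ_trans X).

Definition plus_obj (X : compactum) : Type :=
  {eq_quot (same_germ_equiv X)}%qT.

Definition in_plus (X : compactum) (n : nat) (a : iter_obj n X) : plus_obj X :=
  (\pi_(plus_obj X) (existT _ n a : stage X))%qT.

(* Any two points of F^+ X come from a common F^n X; the distance is computed *)
(* there, and does not depend on n when the bonding maps are isometric (see   *)
(* plus_distE).                                                               *)
Definition plus_dist (L : metric_lift) (X : compactum) (rho : metric_on R X)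
    (P Q : plus_obj X) : R :=
  xget 0 [set r | exists n (a b : iter_obj n X),
    [/\ P = in_plus a, Q = in_plus b & r = iter_metric L n rho a b]].

Definition plus_map (X Y : compactum) (f : continuousType X Y)
    (P : plus_obj X) : plus_obj Y :=
  let p : stage X := repr P in in_plus (iter_map (tag p) f (tagged p)).

Lemma in_plusP X n (a : iter_obj n X) m (b : iter_obj m X) :
  in_plus a = in_plus b <->
  exists k l, iter k (@bond X) (existT _ n a) = iter l (@bond X) (existT _ m b).
Proof.
rewrite /in_plus; split.
  by move=> /eqmodP/asboolP.
by move=> h; apply/eqmodP/asboolP.
Qed.

Lemma plus_mapE (X Y : compactum) (f : continuousType X Y) n
    (a : iter_obj n X) :
  plus_map f (in_plus a) = in_plus (iter_map n f a).
Proof.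
pose m (p : stage X) : stage Y := existT _ (tag p) (iter_map (tag p) f (tagged p)).
have mb k p : m (iter k (@bond X) p) = iter k (@bond Y) (m p).
  elim: k => //= k <-; case: (iter k _ p) => j c; rewrite /m /=.
  by have /= -> := naturality eta (iter_map j f) c.
rewrite /plus_map; set p := repr _.
have /in_plusP[k [l kl]] : in_plus (tagged p) = in_plus a.
  rewrite /in_plus -[RHS]reprK -/p; by case: p.
apply/in_plusP; exists k, l.
have -> : existT _ (tag p) (iter_map (tag p) f (tagged p)) = m p by [].
have -> : existT _ n (iter_map n f a) = m (existT _ n a) by [].
by rewrite -!mb -kl; case: p {kl}.
Qed.

Lemma plus_distE (L : metric_lift) (X : compactum) (rho : metric_on R X) :
  (forall (Y : compactum) (d : metric_on R Y), isometric d (L Y d) (eta Y)) ->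
  forall n (a b : iter_obj n X),
  plus_dist L rho (in_plus a) (in_plus b) = iter_metric L n rho a b.
Proof.
move=> isoL.
pose D (p q : stage X) r := exists n (a b : iter_obj n X),
  [/\ p = existT _ n a, q = existT _ n b & r = iter_metric L n rho a b].
have Db k p q r : D p q r -> D (iter k (@bond X) p) (iter k (@bond X) q) r.
  elim: k => //= k IH /IH[n [a [b [-> -> ->]]]].
  by exists n.+1, (eta _ a), (eta _ b); split => //=; rewrite isoL.
have Dinj p q r r' : D p q r -> D p q r' -> r = r'.
  move=> [n [a [b [-> -> ->]]]] [m [c [d [e1 e2 ->]]]].
  have nm : n = m by case: e1.
  move: c d e1 e2; rewrite -{}nm => c d e1 e2.
  have inj (u v : iter_obj n X) :
      existT _ n u = existT _ n v :> stage X -> u = v.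
    move=> uv; apply/eqP.
    have := @eq_Tagged _ (fun n => iter_obj n X : eqType) (existT _ n u) v.
    by move=> /= <-; apply/eqP.
  by rewrite (inj _ _ e1) (inj _ _ e2).
have tagb k (p : stage X) : tag (iter k (@bond X) p) = (k + tag p)%N.
  by elim: k => //= k IH; rewrite addSn -IH; case: (iter k _ p).
move=> n a b; rewrite /plus_dist; case: xgetP => [r ->|/(_ (iter_metric L n rho a b))].
  move=> [m [c [d [/in_plusP[k [l kl]] /in_plusP[k' [l' kl']] ->]]]].
  apply: (Dinj (iter (k' + k) (@bond X) (existT _ n a))
               (iter (k' + k) (@bond X) (existT _ n b))); last first.
    by apply: Db; exists n, a, b.
  have -> : iter (k' + k) (@bond X) (existT _ n a) =
            iter (k' + l) (@bond X) (existT _ m c) by rewrite iterD kl -iterD.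
  have -> : iter (k' + k) (@bond X) (existT _ n b) =
            iter (k' + l) (@bond X) (existT _ m d).
    have := congr1 (@tag _ _) kl'; have := congr1 (@tag _ _) kl.
    rewrite !tagb /= => e e'.
    have <- : (k + l' = k' + l)%N.
      by lia.
    by rewrite [(k' + k)%N]addnC iterD kl' -iterD.
  by apply: Db; exists m, c, d.
by move=> []; exists n, a, b.
Qed.

End Iterates.

Record perfect_metrization (F : endofunctor) (eta : nat_trans id_functor F)
    (psi : nat_trans (sqr_functor F) F) (L : metric_lift F) : Prop := {
  lift_embedding : forall (X1 X2 : compactum)
    (rho1 : metric_on R X1) (rho2 : metric_on R X2) (i : continuousType X1 X2),
    isometric rho1 rho2 i -> isometric (L X1 rho1) (L X2 rho2) (fmap F i);
  lift_unit : forall (X : compactum) (rho : metric_on R X),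
    isometric rho (L X rho) (eta X);
  lift_diam : forall (X : compactum) (rho : metric_on R X),
    diam (L X rho) = diam rho;
  lift_uniform : forall (X1 X2 : compactum)
    (rho1 : metric_on R X1) (rho2 : metric_on R X2) (f : continuousType X1 X2)
    (eps : R), 0 < eps -> exists2 delta : R, 0 < delta &
    forall P Q : plus_obj eta X1, plus_dist L rho1 P Q < delta ->
      plus_dist L rho2 (plus_map f P) (plus_map f Q) < eps;
  lift_mult : forall (X : compactum) (rho : metric_on R X),
    nonexpanding (L (F X) (L X rho)) (L X rho) (psi X);
  lift_mult_unit : forall (X : compactum) (rho : metric_on R X)
    (a : F X) (x0 : X) (b : F (F X)), psi X b = a ->
    L X rho a (eta X x0) = L (F X) (L X rho) b (eta (F X) (eta X x0));
  lift_distance : forall (X : compactum) (rho : metric_on R X)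
    (a : F X) (eps : R),
    eps <= dist_to (L X rho) a (range (eta X)) ->
    eps <= dist_to (L (F X) (L X rho)) (fmap F (eta X) a) (range (eta (F X)))
}.

Definition perfectly_metrizable (F : endofunctor)
    (eta : nat_trans id_functor F) (psi : nat_trans (sqr_functor F) F) : Prop :=
  exists L : metric_lift F, perfect_metrization eta psi L.

End Compacta.

Section IdempotentMeasures.
Variables (R : realType) (X : topologicalType).
Implicit Types (phi psi : continuousType X R) (l : R).

Lemma oplus_continuous phi psi : continuous (phi \max psi : X -> R).
Proof. by apply: max_fun_continuous; exact: cts_fun. Qed.

(* The idempotent operations on functions: phi (+) psi = max(phi, psi) and    *)
(* l (.) phi = phi + l. *)
Definition oplus phi psi : continuousType X R := mkcts (@oplus_continuous phi psi).

Lemma oplusE phi psi x : oplus phi psi x = Num.max (phi x) (psi x).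
Proof. by []. Qed.

Lemma otimes_continuous l phi : continuous (fun x => phi x + l : R).
Proof. by move=> x; apply: cvgD; [exact: cts_fun|exact: cvg_cst]. Qed.

Definition otimes l phi : continuousType X R := mkcts (@otimes_continuous l phi).

Lemma otimesE l phi x : otimes l phi x = phi x + l. Proof. by []. Qed.

Definition idempotent_measures : set {ptws continuousType X R -> R} :=
  [set mu : {ptws continuousType X R -> R} | [/\ forall l, mu (cst l) = l,
    forall l phi, mu (otimes l phi) = mu phi + l &
    forall phi psi, mu (oplus phi psi) = Num.max (mu phi) (mu psi)]].

(* idempotent_measures coerces to a type (set_type), which carries the        *)
(* subspace topology of the topology of pointwise convergence.                *)
Definition ispace : topologicalType := idempotent_measures : Type.

Definition mass (mu : ispace) (phi : continuousType X R) : R := set_val mu phi.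

Lemma mass_cst mu l : mass mu (cst l) = l.
Proof. by have [] := set_mem (valP mu). Qed.

Lemma mass_otimes mu l phi : mass mu (otimes l phi) = mass mu phi + l.
Proof. by have [] := set_mem (valP mu). Qed.

Lemma mass_oplus mu phi psi :
  mass mu (oplus phi psi) = Num.max (mass mu phi) (mass mu psi).
Proof. by have [] := set_mem (valP mu). Qed.

Lemma mass_inj mu nu : mass mu =1 mass nu -> mu = nu.
Proof.
by move=> /funext munu; apply: val_inj; exact: munu.
Qed.

Lemma mass_cvg (F : set_system ispace) (mu : ispace) : Filter F ->
  (forall phi, (fun nu => mass nu phi) @ F --> mass mu phi) -> F --> mu.
Proof.
move=> FF h A [_ [[B oB <-]] Bmu BA].
have : set_val @ F --> (set_val mu : {ptws continuousType X R -> R}).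
  apply/cvg_sup => phi U [_ [[V oV <-]] /= Vmu VU].
  have Vn : F [set nu | V (mass nu phi)] := h phi V (open_nbhs_nbhs (conj oV Vmu)).
  by apply: (@filterS _ F _ _ _ _ Vn) => nu Vnu; exact: VU.
move=> /(_ B (open_nbhs_nbhs (conj oB Bmu))) Bn.
by apply: (@filterS _ F _ (set_val @^-1` B)) => // nu Bnu; exact: BA.
Qed.

Lemma continuous_mass (T : topologicalType) (g : T -> ispace) :
  (forall phi, continuous (fun t => mass (g t) phi)) -> continuous g.
Proof.
move=> h t; apply: (@mass_cvg (g @ t) (g t)) => phi; exact: h.
Qed.

Lemma mass_continuous phi : continuous (fun mu : ispace => mass mu phi).
Proof.
move=> mu; apply: (@continuous_comp _ _ _ set_val (fun f : {ptws _ -> R} => f phi)).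
  exact: initial_continuous.
by apply: (@proj_continuous {classic continuousType X R} (fun=> R)).
Qed.

Definition measure_of (mu : continuousType X R -> R)
  (h1 : forall l, mu (cst l) = l)
  (h2 : forall l phi, mu (otimes l phi) = mu phi + l)
  (h3 : forall phi psi, mu (oplus phi psi) = Num.max (mu phi) (mu psi)) :
  ispace := exist _ (mu : {ptws continuousType X R -> R}) (mem_set (And3 h1 h2 h3)).

Lemma mass_le mu phi psi : (forall x, phi x <= psi x) -> mass mu phi <= mass mu psi.
Proof.
move=> le; have -> : psi = oplus phi psi.
  by apply/continuousEP => x; symmetry; exact: max_r.
by rewrite mass_oplus le_max lexx.
Qed.

Lemma mass_leD mu phi psi l : (forall x, phi x <= psi x + l) ->
  mass mu phi <= mass mu psi + l.
Proof. by move=> h; rewrite -mass_otimes; exact: mass_le. Qed.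

Lemma mass_ball mu phi psi l : (forall x, `|phi x - psi x| <= l) ->
  `|mass mu phi - mass mu psi| <= l.
Proof.
move=> h; rewrite ler_distl; apply/andP; split.
  by rewrite lerBlDr; apply: mass_leD => x; have := h x; rewrite ler_distl lerBlDr => /andP[].
by apply: mass_leD => x; have := h x; rewrite ler_distl => /andP[].
Qed.

End IdempotentMeasures.
Arguments measure_of [R X] mu h1 h2 h3.

Section Push.
Variables (R : realType) (X Y : topologicalType).
Variable (f : continuousType X Y).

Fact push_cst (mu : ispace R X) (l : R) : mass mu ((cst l : continuousType Y R) \o f) = l.
Proof. by rewrite -[RHS](mass_cst mu); congr mass; apply/continuousEP. Qed.

Fact push_otimes (mu : ispace R X) (l : R) (phi : continuousType Y R) :
  mass mu (otimes l phi \o f) = mass mu (phi \o f) + l.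
Proof. by rewrite -mass_otimes; congr mass; apply/continuousEP. Qed.

Fact push_oplus (mu : ispace R X) (phi psi : continuousType Y R) :
  mass mu (oplus phi psi \o f) = Num.max (mass mu (phi \o f)) (mass mu (psi \o f)).
Proof. by rewrite -mass_oplus; congr mass; apply/continuousEP. Qed.

Definition push (mu : ispace R X) : ispace R Y :=
  measure_of (fun phi : continuousType Y R => mass mu (phi \o f))
    (push_cst mu) (push_otimes mu) (push_oplus mu).

Fact push_continuous : continuous push.
Proof. by apply: continuous_mass => phi; exact: mass_continuous. Qed.

Definition imap : continuousType (ispace R X) (ispace R Y) := mkcts push_continuous.

End Push.

Section Dirac.
Variables (R : realType) (X : topologicalType).

Definition dirac (x : X) : ispace R X :=
  measure_of (fun phi : continuousType X R => phi x)
    (fun=> erefl) (fun _ _ => erefl) (fun _ _ => erefl).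

Fact dirac_continuous : continuous dirac.
Proof. by apply: continuous_mass => phi; exact: cts_fun. Qed.

Definition ieta : continuousType X (ispace R X) := mkcts dirac_continuous.

(* The function mu |-> mu(phi) on the space of idempotent measures. *)
Definition bar (phi : continuousType X R) : continuousType (ispace R X) R :=
  mkcts (@mass_continuous R X phi).

Section mult.
Variable M : ispace R (ispace R X).

Fact mult_cst (l : R) : mass M (bar (cst l)) = l.
Proof.
by rewrite -[RHS](mass_cst M); congr mass; apply/continuousEP => mu; exact: mass_cst.
Qed.

Fact mult_otimes (l : R) (phi : continuousType X R) :
  mass M (bar (otimes l phi)) = mass M (bar phi) + l.
Proof.
rewrite -mass_otimes; congr mass; apply/continuousEP => mu; exact: mass_otimes.
Qed.

Fact mult_oplus (phi psi : continuousType X R) :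
  mass M (bar (oplus phi psi)) = Num.max (mass M (bar phi)) (mass M (bar psi)).
Proof.
rewrite -mass_oplus; congr mass; apply/continuousEP => mu; exact: mass_oplus.
Qed.

Definition mult : ispace R X :=
  measure_of (fun phi => mass M (bar phi)) mult_cst mult_otimes mult_oplus.
End mult.

Fact mult_continuous : continuous mult.
Proof. by apply: continuous_mass => phi; exact: mass_continuous. Qed.

Definition ipsi : continuousType (ispace R (ispace R X)) (ispace R X) :=
  mkcts mult_continuous.

End Dirac.

Section IdempotentCompact.
Variables (R : realType) (X : topologicalType).
Context (cX : compact [set: X]).

Lemma continuous_bounded (phi : continuousType X R) :
  exists M : R, forall x, `|phi x| <= M.
Proof.
have /compact_bounded[M [_ h]] : compact (phi @` [set: X]).
  apply: continuous_compact => //; apply: continuous_subspaceT.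
  exact: cts_fun.
by exists (M + 1) => x; apply: (h (M + 1)); [rewrite ltrDl|exists x].
Qed.

Lemma ispace_compact : compact [set: ispace R X].
Proof.
rewrite compact_ultra => F FU _.
have cvgF phi : exists l : R, (fun nu => mass nu phi) @ F --> l.
  have [M hM] := continuous_bounded phi.
  have := @segment_compact R (- M) M ((fun nu => mass nu phi) @ F) _.
  case.
    apply: (@filterS _ F _ setT); last exact: filterT.
    move=> nu _ /=; rewrite in_itv/= -ler_norml -[mass _ _]subr0 -(mass_cst nu 0).
    by apply: mass_ball => x; rewrite /cst subr0.
  move=> l [_ cl]; exists l => V Vl.
  have [//|FV] := in_ultra_setVsetC ((fun nu => mass nu phi) @^-1` V) FU.
  have [r [nVr Vr]] := cl (~` V) V FV Vl.
  by case: nVr.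
have [L LE] := choice cvgF.
have cst_lim (r : R) : (fun _ : ispace R X => r) @ F --> r by exact: cvg_cst.
have L1 l : L (cst l) = l.
  apply: (@cvg_unique _ (@Rhausdorff R) _ _ _ _ (LE (cst l))).
  have -> : (fun nu => mass nu (cst l)) = (fun _ : ispace R X => l).
    by apply/funext => nu; exact: mass_cst.
  exact: cst_lim.
have L2 l phi : L (otimes l phi) = L phi + l.
  apply: (@cvg_unique _ (@Rhausdorff R) _ _ _ _ (LE (otimes l phi))).
  have -> : (fun nu => mass nu (otimes l phi)) =
      (fun nu : ispace R X => mass nu phi + l).
    by apply/funext => nu; exact: mass_otimes.
  apply: cvgD; [exact: LE|exact: cst_lim].
have L3 phi psi : L (oplus phi psi) = Num.max (L phi) (L psi).
  apply: (@cvg_unique _ (@Rhausdorff R) _ _ _ _ (LE (oplus phi psi))).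
  have -> : (fun nu => mass nu (oplus phi psi)) =
      (fun nu : ispace R X => Num.max (mass nu phi) (mass nu psi)).
    by apply/funext => nu; exact: mass_oplus.
  apply: continuous2_cvg; [|exact: LE|exact: LE].
  by move=> U; apply: (@max_continuous _ R (L phi, L psi)).
exists (measure_of L L1 L2 L3); split => //.
exact: mass_cvg.
Qed.

Variable rho : metric_on R X.

Lemma cone_continuous (k : nat) (x : X) : continuous (fun y => - (k%:R * rho x y)).
Proof.
move=> y; apply: cvgN; apply: cvgM; first exact: cvg_cst.
apply/cvgrPdist_lt => e e0.
apply: filterS (metric_near rho y e0) => z yz.
rewrite ltr_distl; apply/andP; split.
  by rewrite ltrBlDr (le_lt_trans (metric_triangle rho y x z))// ltrD2l.
rewrite (le_lt_trans (metric_triangle rho z x y))// ltrD2l.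
by rewrite metric_sym.
Qed.

Definition cone (k : nat) (x : X) : continuousType X R := mkcts (@cone_continuous k x).

Lemma coneE k x y : cone k x y = - (k%:R * rho x y). Proof. by []. Qed.

Lemma cone_dist (k : nat) (x x' y : X) :
  `|cone k x y - cone k x' y| <= k%:R * rho x x'.
Proof.
have -> : cone k x y - cone k x' y = k%:R * (rho x' y - rho x y).
  by rewrite !coneE mulrBr opprK addrC.
rewrite normrM ger0_norm// ler_wpM2l// ler_distl; apply/andP; split.
  by rewrite lerBlDr addrC (metric_triangle rho x').
by rewrite addrC (metric_sym rho x) (metric_triangle rho x).
Qed.

Lemma rho_bounded : exists M : R, forall x y, rho x y <= M.
Proof.
have [[x0 _]|X0] := pselect (exists x : X, True); last first.
  by exists 0 => x; exfalso; apply: X0; exists x.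
have [M hM] := continuous_bounded (cone 1 x0).
have {}hM x : rho x0 x <= M.
  by have := hM x; rewrite !coneE mul1r normrN ger0_norm ?metric_ge0.
exists (M + M) => x y; apply: le_trans (metric_triangle rho x0 x y) _.
by rewrite lerD// metric_sym.
Qed.

Lemma cone_sep (mu nu : ispace R X) :
  (forall k x, mass mu (cone k x) = mass nu (cone k x)) ->
  forall phi, mass mu phi <= mass nu phi.
Proof.
move=> eq_cone phi; apply/ler_addgt0Pr => e e0.
have [M hM] := continuous_bounded phi.
have M0 (x : X) : 0 <= M by exact: le_trans (normr_ge0 (phi x)) (hM x).
pose e2 := e / 2; have e20 : 0 < e2 by rewrite divr_gt0.
have kx x : exists k : nat, forall y, phi x + cone k x y <= phi y + e2.
  have : \forall y \near x, `|phi x - phi y| < e2.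
    by have /cvgrPdist_lt := @cts_fun _ _ phi x; exact.
  rewrite /prop_near1 (metric_nbhs rho) => -[d /= d0 hd].
  exists (Num.truncn (2 * M / d)).+1 => y.
  have [xy|dxy] := ltP (rho x y) d.
    rewrite (@le_trans _ _ (phi x))//.
      by rewrite gerDl coneE oppr_le0 mulr_ge0 ?metric_ge0.
    by have := hd _ xy; rewrite ltr_distl => /andP[_ /ltW].
  rewrite (@le_trans _ _ (- M))//; last first.
    have /andP[] : - M <= phi y <= M by rewrite -ler_norml.
    by move=> My _; rewrite (le_trans My)// lerDl ltW.
  rewrite !coneE lerBlDr.
  have xM : phi x <= M by rewrite (le_trans (ler_norm _)).
  apply: (le_trans xM); rewrite -lerBlDl opprK.
  apply: (@le_trans _ _ ((2 * M / d) * d)).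
    by rewrite divfK ?gt_eqF// mulr_natl mulr2n.
  by apply: ler_pM; rewrite ?divr_ge0 ?mulr_ge0 ?(M0 x) ?(ltW d0) ?(ltW (truncnS_gt _)).
have [K hK] := choice kx.
pose g x := otimes (phi x) (cone (K x) x).
have gle x : mass mu (g x) <= mass nu phi + e2.
  rewrite mass_otimes eq_cone -mass_otimes; apply: mass_leD => y.
  by rewrite otimesE addrC.
pose F := filter_from [set: seq X] (fun s => [set t : seq X | {subset s <= t}]).
have FF : Filter F.
  apply: filter_from_filter; first by exists [::].
  move=> s t _ _; exists (s ++ t) => // u /= sub; split => x xs; apply: sub;
    by rewrite mem_cat xs ?orbT.
have [D _ covD] : \forall s \near F,
    [set: X] `<=` (fun y => exists2 x, x \in s & phi y < g x y + e2).
  move/compact_near_coveringP : cX; apply => x _.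
  exists ([set y | phi y < g x y + e2], [set s | x \in s]); last first.
    by move=> [y s] [/= ? ?]; exists x.
  split=> /=; last by exists [:: x] => // s; apply; rewrite inE.
  have : {for x, continuous (fun y => g x y - phi y)}.
    by apply: cvgB; exact: cts_fun.
  move=> /cvgrPdist_lt /(_ e2 e20); apply: filterS => y.
  have -> : g x x - phi x = 0.
    by rewrite otimesE coneE metric_xx mulr0 oppr0 add0r subrr.
  by rewrite sub0r normrN ltr_norml => /andP[+ _]; rewrite ltrNl opprB ltrBlDl.
have {}covD y := covD D (fun x => id) y I.
have [h [hle hge]] : exists h : continuousType X R, mass mu h <= mass nu phi + e2 /\
    forall x, x \in D -> forall y, g x y <= h y.
  elim: {covD} D => [|x s [h [h1 h2]]].
    by exists (cst (mass nu phi + e2)); split=> //; rewrite mass_cst.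
  exists (oplus (g x) h); split; first by rewrite mass_oplus ge_max gle.
  move=> z; rewrite inE => /orP[/eqP ->|zs] y; rewrite oplusE le_max ?lexx//.
  by rewrite h2 ?orbT.
apply: (@le_trans _ _ (mass mu h + e2)); last first.
  by rewrite (splitr e) addrA lerD2r.
apply: mass_leD => y; have [x xD] := covD y.
by move=> /ltW/le_trans; apply; rewrite lerD2r hge.
Qed.

Lemma ispace_metrizable : inhabited (metric_on R (ispace R X)).
Proof.
pose A k (mu nu : ispace R X) : set R := [set r | r = 0 \/
  exists x, r = `|mass mu (cone k x) - mass nu (cone k x)|].
have supA k mu nu : has_sup (A k mu nu).
  split; first by exists 0; left.
  have [M hM] := rho_bounded.
  have bnd (la : ispace R X) x : `|mass la (cone k x)| <= k%:R * M.
    rewrite -[mass _ _]subr0 -(mass_cst la 0); apply: mass_ball => y.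
    rewrite /cst subr0 !coneE normrN normrM ger0_norm//.
    by rewrite ler_wpM2l// ger0_norm ?metric_ge0.
  have [[x0 _]|X0] := pselect (exists x : X, True); last first.
    by exists 0 => r [->//|[x _]]; exfalso; apply: X0; exists x.
  exists (k%:R * M + k%:R * M) => r [->|[x ->]].
    by rewrite addr_ge0// (le_trans _ (bnd mu x0)).
  by rewrite (le_trans (ler_normB _ _))// lerD.
pose p k mu nu := sup (A k mu nu).
have pge k mu nu x : `|mass mu (cone k x) - mass nu (cone k x)| <= p k mu nu.
  by apply: sup_upper_bound; [exact: supA|right; exists x].
have p0 k mu nu : 0 <= p k mu nu.
  by apply: sup_upper_bound; [exact: supA|left].
have ple k mu nu e : 0 <= e ->
    (forall x, `|mass mu (cone k x) - mass nu (cone k x)| <= e) -> p k mu nu <= e.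
  move=> e0 h; apply: ge_sup; first exact: (supA k mu nu).1.
  by move=> r [->//|[x ->]].
apply: (@compact_metrizable R _ p) => //; first exact: ispace_compact.
- move=> k mu; apply/eqP; rewrite eq_le p0 andbT; apply: ple => // x.
  by rewrite subrr normr0.
- by move=> k mu nu; apply/eqP; rewrite eq_le; apply/andP; split;
    apply: ple => // x; rewrite distrC pge.
- move=> k la mu nu; apply: ple => [|x]; first by rewrite addr_ge0.
  by rewrite (le_trans (ler_distD (mass la (cone k x)) _ _))// lerD.
- move=> k mu e e0.
  have /compact_near_coveringP nc := cX.
  have : \forall nu \near nbhs mu, [set: X] `<=`
      (fun x => `|mass mu (cone k x) - mass nu (cone k x)| <= e / 2).
    apply: (nc _ (nbhs mu) (fun nu x =>
      `|mass mu (cone k x) - mass nu (cone k x)| <= e / 2)) => x _.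
    near=> x' nu => /=.
    have xx' : k%:R * rho x x' <= e / 8.
      apply: (@le_trans _ _ (k.+1%:R * rho x x')).
        by rewrite ler_wpM2r ?metric_ge0// ler_nat.
      rewrite mulrC -ler_pdivlMr// ltW//; near: x'.
      by apply: metric_near; rewrite !divr_gt0.
    have x'x : k%:R * rho x' x <= e / 8 by rewrite metric_sym.
    have munu : `|mass mu (cone k x) - mass nu (cone k x)| < e / 4.
      near: nu; have /cvgrPdist_lt := @mass_continuous R X (cone k x) mu.
      by apply; rewrite divr_gt0.
    have e1 := le_trans (mass_ball mu (cone_dist k x' x)) x'x.
    have e2 := le_trans (mass_ball nu (cone_dist k x x')) xx'.
    rewrite (le_trans (ler_distD (mass mu (cone k x)) _ _))//.
    rewrite [leRHS](_ : _ = e / 8 + (e / 4 + e / 8)); last by lra.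
    rewrite lerD// (le_trans (ler_distD (mass nu (cone k x)) _ _))//.
    by rewrite lerD// ltW.
  apply: filterS => nu h; apply: (@le_lt_trans _ _ (e / 2)).
    by apply: ple => [|x]; [rewrite divr_ge0// ltW|exact: h].
  by rewrite ltr_pdivrMr// ltr_pMr// ltr1n.
- move=> mu nu pmn.
  have eq_cone k x : mass mu (cone k x) = mass nu (cone k x).
    apply/eqP; rewrite -subr_eq0 -normr_le0 -(pmn k); exact: pge.
  apply: mass_inj => phi; apply/eqP; rewrite eq_le.
  by rewrite !cone_sep// => k x; rewrite eq_cone.
Unshelve. all: by end_near. Qed.

End IdempotentCompact.

Section IdempotentFunctor.
Variable R : realType.

Lemma idem_metrizable (X : compactum R) : inhabited (metric_on R (ispace R X)).
Proof.
have [rho] := compactum_metrizable X.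
exact: (ispace_metrizable (@compactum_compact R X) rho).
Qed.

Definition idem_obj (X : compactum R) : compactum R :=
  Compactum (ispace_compact (@compactum_compact R X)) (idem_metrizable X).

Fact idem_map_id (X : compactum R) :
  imap R (idfun : continuousType X X) =1 idfun.
Proof.
move=> mu; apply: mass_inj => phi.
by rewrite /mass /=; congr (set_val mu _); apply/continuousEP.
Qed.

Fact idem_map_comp (X Y Z : compactum R) (g : continuousType Y Z)
    (f : continuousType X Y) :
  imap R (g \o f : continuousType X Z) =1 imap R g \o imap R f.
Proof.
move=> mu; apply: mass_inj => phi.
by rewrite /mass /=; congr (set_val mu _); apply/continuousEP.
Qed.

Definition idem_functor : endofunctor R :=
  @Endofunctor R idem_obj (fun X Y f => imap R f) idem_map_id idem_map_comp.

Fact idem_unit_natural (X Y : compactum R) (f : continuousType X Y) :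
  ieta R Y \o f =1 imap R f \o ieta R X.
Proof. by move=> x; exact: mass_inj. Qed.

Definition idem_unit : nat_trans (id_functor R) idem_functor :=
  @NatTrans R (id_functor R) idem_functor (fun X => ieta R X) idem_unit_natural.

Fact idem_mult_natural (X Y : compactum R) (f : continuousType X Y) :
  ipsi R Y \o imap R (imap R f) =1 imap R f \o ipsi R X.
Proof.
move=> M; apply: mass_inj => phi.
by rewrite /mass /=; congr (set_val M _); apply/continuousEP.
Qed.

Definition idem_mult : nat_trans (sqr_functor idem_functor) idem_functor :=
  @NatTrans R (sqr_functor idem_functor) idem_functor (fun X => ipsi R X)
    idem_mult_natural.

End IdempotentFunctor.

(* Main.v *)
Require Import Defs.
From mathcomp Require Import all_boot all_order all_algebra.
From mathcomp Require Import all_classical all_reals topology normedtype.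
From mathcomp Require Import lra.

Set Implicit Arguments.
Unset Strict Implicit.
Unset Printing Implicit Defensive.

(* The [metric_sym] of [Defs] has to shadow the one of [topology]. *)
Import Defs.
Import Order.TTheory GRing.Theory Num.Theory.
Import numFieldNormedType.Exports.

Local Open Scope classical_set_scope.
Local Open Scope ring_scope.

(* Write an idempotent measure through its density: mu(phi) is the maximum of
   lambda_mu(x) + phi(x).  The distance of mu and nu is the least d > 0 such
   that for every x there is a y with
     lambda_mu(x) <= lambda_nu(y) - gap d (rho x y),
   and symmetrically.  With l(r) = r - 1/r, gap d r is r - d for r <= d and
   l(r) - l(d) for r >= d: moving by exactly d is free, moving further costs
   density, moving less leaves room for a gain of density.  Densities are
   avoided by testing on pairs of functions with
   phi(x) <= psi(y) + gap d (rho x y), see [lag].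

   The triangle inequality and (P1) follow from the subadditivity of gap by
   sup-convolution, and (P5) from gap d r <= gap d s + gap s r.  Up to an
   arbitrarily small change of d, the distance of mu to the Dirac measure at z
   is less than d iff mu takes a negative value at gap d (rho . z); as this only
   involves the value of mu at one function, it is compatible with psi_X, which
   gives (P6) and (P7).  For (P4), a continuous f satisfies
   rho2(f x, f y) <= c + w(rho1(x, y)) for a modulus w = dilate eta under which
   gap does not increase; I(f) inherits this inequality with the same c and w,
   so it holds for all I^n(f). *)

(** * The gap function and the moduli of continuity compatible with it *)

Section Gap.
Variable R : realType.
Implicit Types d r s c : R.

(* [Num.max r d] in place of [r] also avoids the junk value 0^-1 = 0. *)
Definition gap d r : R := r - d + (d^-1 - (Num.max r d)^-1).

Lemma subVV (a b : R) : a != 0 -> b != 0 -> a^-1 - b^-1 = (b - a) * (a * b)^-1.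
Proof.
move=> a0 b0; rewrite invfM mulrBl mulrCA mulfV// mulr1.
by rewrite mulrA mulfV// mul1r.
Qed.

Lemma gap_small d r : r <= d -> gap d r = r - d.
Proof. by move=> rd; rewrite /gap max_r// subrr addr0. Qed.

Lemma gap_large d r : d <= r -> gap d r = r - d + (d^-1 - r^-1).
Proof. by move=> rd; rewrite /gap max_l. Qed.

Lemma gap_ge d r : 0 < d -> r - d <= gap d r.
Proof.
move=> d0; rewrite /gap lerDl subr_ge0 lef_pV2 ?posrE ?lt_max ?d0 ?orbT//.
by rewrite le_max lexx orbT.
Qed.

Lemma gap_ge0 d r : 0 < d -> d <= r -> 0 <= gap d r.
Proof. by move=> d0 dr; apply: le_trans (gap_ge r d0); rewrite subr_ge0. Qed.

(** The slope of [gap d] is 1 below d and 1 + r^-2 above it. *)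
Lemma gap_lip d r s : 0 < d -> `|gap d r - gap d s| <= (1 + d^-2) * `|r - s|.
Proof.
move=> d0; wlog rs : r s / s <= r => [h|].
  by have [/h//|/ltW/h] := leP s r; rewrite distrC (distrC r).
have h (a b : R) : d <= b -> b <= a -> 0 <= b^-1 - a^-1 <= d^-2 * (a - b).
  move=> db ba; have b0 : 0 < b by exact: lt_le_trans db.
  have a0 : 0 < a by exact: lt_le_trans ba.
  rewrite (subVV (lt0r_neq0 b0) (lt0r_neq0 a0)) mulrC (mulrC b).
  rewrite mulr_ge0 ?invr_ge0 ?mulr_ge0 ?(ltW a0) ?(ltW b0) ?subr_ge0//=.
  rewrite ler_wpM2r ?subr_ge0// lef_pV2 ?posrE ?mulr_gt0//.
  by rewrite expr2 ler_pM ?(ltW d0)// (le_trans db).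
have := h (Num.max r d) (Num.max s d).
rewrite le_max lexx orbT => /(_ isT).
have ms : Num.max s d <= Num.max r d by rewrite ge_max !le_max rs lexx orbT.
move=> /(_ ms) /andP[lo hi].
have mrs : Num.max r d - Num.max s d <= r - s.
  by have [] := leP r d; have [] := leP s d; lra.
have hi' : d^-2 * (Num.max r d - Num.max s d) <= d^-2 * (r - s).
  by rewrite ler_wpM2l// invr_ge0 exprn_ge0 ?ltW.
have rs0 : 0 <= d^-2 * (r - s).
  by rewrite mulr_ge0 ?subr_ge0// invr_ge0 exprn_ge0 ?ltW.
rewrite (@ger0_norm _ (r - s)) ?subr_ge0//.
by rewrite ler_norml /gap mulrDl mul1r; apply/andP; split; lra.
Qed.

Lemma gap_le d r s : 0 < d -> r <= s -> gap d r <= gap d s.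
Proof.
move=> d0 rs; rewrite /gap lerD ?lerB// lef_pV2 ?posrE ?lt_max ?d0 ?orbT//.
by rewrite ge_max !le_max rs lexx orbT.
Qed.

Lemma gap_lt0 d r : 0 < d -> gap d r < 0 -> r < d.
Proof. by move=> d0; apply: contraTT; rewrite -!leNgt; exact: gap_ge0. Qed.

(** The linear terms cancel; what remains is max(d, s)^-1 + max(s, r)^-1 <= s^-1 + max(d, r)^-1,
    with equality for d <= s <= r. *)
Lemma gap_comp d s r : 0 < d -> 0 < s -> gap d r <= gap d s + gap s r.
Proof.
move=> d0 s0; rewrite /gap.
have dV : 0 < d^-1 by rewrite invr_gt0.
have iV (a b : R) : 0 < a -> a <= b -> b^-1 <= a^-1.
  by move=> a0 ab; rewrite lef_pV2 ?posrE// (lt_le_trans a0).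
have [sd|ds] := leP s d.
  have [rd|dr] := leP r d.
    have [rs|sr] := leP r s; first by lra.
    by have := iV _ _ s0 (ltW sr); lra.
  have sr := le_trans sd (ltW dr).
  by rewrite (max_l sr); have := iV _ _ s0 sd; lra.
have [rs|sr] := leP r s; first last.
  by rewrite (max_l (ltW (lt_trans ds sr))); lra.
have [rd|dr] := leP r d; first by have := iV _ _ d0 (ltW ds); lra.
by have := iV _ _ (lt_trans d0 dr) rs; lra.
Qed.

Lemma gap_anti d s r : 0 < d -> d <= s -> gap s r <= gap d r.
Proof.
move=> d0 ds; have s0 := lt_le_trans d0 ds.
by apply: (le_trans (gap_comp r s0 d0)); rewrite (gap_small ds); lra.
Qed.

(** With m = max(r, d), the reciprocal part of [gap d r] is (m - d) / (d m). Once max(r + r', d +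
    d') is replaced by m + m', the numerators add up while the denominators grow. *)
Lemma gap_add d d' r r' : 0 < d -> 0 < d' ->
  gap (d + d') (r + r') <= gap d r + gap d' r'.
Proof.
move=> d0 d'0; rewrite /gap.
set m := Num.max r d; set m' := Num.max r' d'.
have md : d <= m by rewrite le_max lexx orbT.
have md' : d' <= m' by rewrite le_max lexx orbT.
have rm : r <= m by rewrite le_max lexx.
have rm' : r' <= m' by rewrite le_max lexx.
have m0 : 0 < m by exact: lt_le_trans md.
have m'0 : 0 < m' by exact: lt_le_trans md'.
have : (m + m')^-1 <= (Num.max (r + r') (d + d'))^-1.
  by rewrite lef_pV2 ?posrE ?addr_gt0// ?lt_max ?(addr_gt0 d0 d'0) ?orbT// ge_max !lerD.
suff : (d + d')^-1 - (m + m')^-1 <= d^-1 - m^-1 + (d'^-1 - m'^-1) by lra.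
rewrite !subVV ?lt0r_neq0 ?addr_gt0//.
have -> : m + m' - (d + d') = (m - d) + (m' - d') by lra.
rewrite mulrDl; apply: lerD; rewrite ler_wpM2l ?subr_ge0// lef_pV2 ?posrE ?mulr_gt0 ?addr_gt0//.
  by apply: ler_pM; rewrite ?lerDl ltW.
by apply: ler_pM; rewrite ?lerDr ltW.
Qed.

(** Moving by eta becomes arbitrarily expensive as d tends to 0, so small lags detect the
    topology. *)
Lemma gap_cvgy (eta M : R) : 0 < eta -> exists2 d0, 0 < d0 &
  forall d r, 0 < d -> d <= d0 -> eta <= r -> M <= gap d r.
Proof.
move=> e0; pose M' := Num.max M 1.
have M'0 : 0 < M' by rewrite lt_max ltr01 orbT.
have eV : 0 < eta^-1 by rewrite invr_gt0.
have s0 : 0 < M' + eta^-1 by rewrite addr_gt0.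
(* This makes d^-1 - eta^-1 at least M'; M' > 0 also forces d <= eta. *)
exists (M' + eta^-1)^-1; first by rewrite invr_gt0.
move=> d r d0 dd er.
have {}dd : M' + eta^-1 <= d^-1 by rewrite -[leLHS]invrK lef_pV2 ?posrE ?invr_gt0.
have de : d <= eta.
  rewrite -lef_pV2 ?posrE//; apply: le_trans dd.
  by rewrite lerDr ltW.
apply: le_trans (gap_le d0 er); rewrite (gap_large de).
have : M <= M' by rewrite le_max lexx.
by move: dd de; lra.
Qed.

Lemma gap_prod d r : 0 < d -> d <= r -> gap d r = (r - d) * (1 + (d * r)^-1).
Proof.
move=> d0 dr; rewrite gap_large// subVV ?lt0r_neq0//; last exact: lt_le_trans dr.
by rewrite mulrDr mulr1.
Qed.

(* eta^-2 is the largest slope on [0, eta] for which [gap_dilate] holds. *)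
Definition dilate (eta r : R) : R := r + (eta^-2 - 1) * Num.min r eta.

Section Dilate.
Variable eta : R.
Hypotheses (eta0 : 0 < eta) (eta1 : eta <= 1).
Local Notation dil := (dilate eta).
Local Notation K := (eta^-2).

Let K1 : 1 <= K.
Proof. by rewrite invf_ge1 ?exprn_gt0// exprn_ile1 ?(ltW eta0). Qed.

Lemma dilateB r s : s <= r -> r - s <= dil r - dil s <= K * (r - s).
Proof.
move=> sr; rewrite /dilate.
have h : 0 <= Num.min r eta - Num.min s eta <= r - s.
  by have [] := leP r eta; have [] := leP s eta; lra.
move: h => /andP[h1 h2]; have k0 : 0 <= K - 1 by rewrite subr_ge0.
have := mulr_ge0 k0 h1; have := ler_wpM2l k0 h2.
by move=> *; apply/andP; split; nra.
Qed.

Lemma dilate0 : dil 0 = 0.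
Proof. by rewrite /dilate min_l ?(ltW eta0)// mulr0 addr0. Qed.

Lemma dilate_bounds r : 0 <= r -> r <= dil r <= K * r.
Proof. by move=> r0; have := dilateB r0; rewrite dilate0 !subr0. Qed.

(** For r <= d both gaps are linear and dilation stretches a nonpositive difference. For d <= r, cut
    at eta: below it [dilate] is multiplication by K, above it a translation that enlarges the
    denominators in [gap_prod]. *)
Lemma gap_dilate c d r : 0 <= c -> 0 < d ->
  gap (c + dil d) (c + dil r) <= gap d r.
Proof.
move=> c0 d0.
have pos s : 0 < s -> 0 < c + dil s.
  by move=> s0; have /andP[+ _] := dilate_bounds (ltW s0); lra.
have [rd|/ltW dr] := leP r d.
  have /andP[h _] := dilateB rd.
  by rewrite !gap_small//; lra.
have scale u v : 0 < u -> u <= v -> v <= eta ->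
    gap (c + dil u) (c + dil v) <= gap u v.
  move=> u0 uv ve; have v0 := lt_le_trans u0 uv; have ue := le_trans uv ve.
  have dE w : w <= eta -> dil w = K * w.
    by move=> we; rewrite /dilate min_l//; lra.
  have /andP[uvD _] := dilateB uv.
  rewrite !gap_prod ?pos//; last by lra.
  rewrite !dE// in uvD *.
  have -> : c + K * v - (c + K * u) = (v - u) * K by lra.
  rewrite -mulrA ler_wpM2l ?subr_ge0//.
  have Ku : 0 < K * u by rewrite mulr_gt0// (lt_le_trans ltr01).
  have Kv : 0 < K * v by rewrite mulr_gt0// (lt_le_trans ltr01).
  have KK : K * eta ^+ 2 = 1 by rewrite mulVf// expf_neq0// lt0r_neq0.
  (* The claim is K (1 + q) <= 1 + p with p = (u v)^-1 and q the reciprocal on the left. Here q <= p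
     / K^2, and K + p / K <= 1 + p because 1 <= K <= p. *)
  have P1 : ((c + K * u) * (c + K * v))^-1 <= eta ^+ 2 * (eta ^+ 2 * (u * v)^-1).
    have -> : eta ^+ 2 * (eta ^+ 2 * (u * v)^-1) = ((K * u) * (K * v))^-1.
      by move: (eta ^+ 2) => e; rewrite !invfM !invrK mulrA [RHS]mulrACA.
    have cp w : 0 < w -> 0 < c + w by move=> w0; rewrite ltr_wpDl.
    rewrite lef_pV2 ?posrE; [|by rewrite mulr_gt0 ?cp|by rewrite mulr_gt0].
    by apply: ler_pM; rewrite ?(ltW Ku) ?(ltW Kv) ?lerDr.
  have P2 : K <= (u * v)^-1.
    by rewrite lef_pV2 ?posrE ?mulr_gt0 ?exprn_gt0// expr2 ler_pM// ltW.
  have K0 : 0 <= K by rewrite (le_trans ler01).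
  have := ler_wpM2l K0 P1; rewrite [leRHS]mulrA KK mul1r.
  have e21 : eta ^+ 2 <= 1 by rewrite exprn_ile1 ?(ltW eta0).
  move: P2 KK e21; move: K (eta ^+ 2) (u * v)^-1 ((_ * _)^-1) => k e p q.
  by nra.
have shift u v : 0 < u -> u <= v -> eta <= u ->
    gap (c + dil u) (c + dil v) <= gap u v.
  move=> u0 uv eu; have v0 := lt_le_trans u0 uv; have ev := le_trans eu uv.
  have /andP[uvD _] := dilateB uv.
  rewrite !gap_prod ?pos//; last by lra.
  have -> : c + dil v - (c + dil u) = v - u by rewrite /dilate !min_r//; lra.
  rewrite ler_wpM2l ?subr_ge0// lerD2l lef_pV2 ?posrE ?mulr_gt0 ?pos//.
  have /andP[ud _] := dilate_bounds (ltW u0).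
  have /andP[vd _] := dilate_bounds (ltW v0).
  by apply: ler_pM; rewrite ?(ltW u0) ?(ltW v0)//; lra.
have [re|/ltW er] := leP r eta; first exact: scale.
have [ed|/ltW de] := leP eta d; first exact: shift.
(* For d < eta < r, [gap d r] is exactly the sum of its two pieces at eta, and the dilated gap is at
   most the sum of its own. *)
apply: (le_trans (gap_comp _ (pos d d0) (pos eta eta0))).
have -> : gap d r = gap d eta + gap eta r by rewrite !gap_large//; lra.
by apply: lerD; [exact: scale|exact: shift].
Qed.

End Dilate.

Lemma dilate_large (delta M : R) : 0 < delta -> exists2 eta, 0 < eta <= 1 &
  forall r, delta <= r -> M <= dilate eta r.
Proof.
(* The three bounds give eta <= 1, eta <= delta, and r + N - N^-1 >= M for r >= N^-1. *)
move=> d0; pose N := Num.max 1 (Num.max (delta^-1) (M + 1)).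
have N1 : 1 <= N by rewrite le_max lexx.
have N0 : 0 < N by exact: lt_le_trans N1.
have e1 : N^-1 <= 1 by rewrite invf_le1.
exists N^-1; first by rewrite invr_gt0 N0.
move=> r dr.
have Nr : N^-1 <= r.
  apply: le_trans dr; rewrite -[leRHS]invrK lef_pV2 ?posrE ?invr_gt0//.
  by rewrite !le_max lexx !orbT.
rewrite /dilate (min_r Nr) exprVn invrK mulrBl expr2 mulfK ?lt0r_neq0// mul1r.
have : M + 1 <= N by rewrite !le_max lexx !orbT.
have : 0 <= N^-1 by rewrite invr_ge0 ltW.
by move: Nr; lra.
Qed.

End Gap.

(** * Convolutions *)

Section MetricSpaces.
Variable R : realType.

Lemma metric_lip (X : topologicalType) (rho : metric_on R X) x y z :
  `|rho x y - rho x z| <= rho y z.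
Proof.
have := metric_triangle rho z x y; have := metric_triangle rho y x z.
by rewrite (metric_sym rho z y) ler_norml => ? ?; apply/andP; split; lra.
Qed.

Lemma lip_continuous (X : topologicalType) (rho : metric_on R X) (f : X -> R)
    (C : R) :
  (forall x y, `|f x - f y| <= C * rho x y) -> continuous f.
Proof.
move=> fC x; apply/cvgrPdist_lt => e e0.
have C0 : 0 < `|C| + 1 by rewrite ltr_wpDl.
apply: filterS (metric_near rho x (divr_gt0 e0 C0)) => y xy.
apply: (le_lt_trans (fC x y)); rewrite ltr_pdivlMr// mulrC in xy.
apply: le_lt_trans xy; rewrite ler_wpM2r ?metric_ge0//.
by rewrite (le_trans (ler_norm C))// lerDl.
Qed.

(** Near-covering compactness is applied to the filter of finite lists ordered by inclusion. *)
Lemma compact_finite_cover (X : topologicalType) (U : X -> set X) :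
  compact [set: X] -> (forall x, nbhs x (U x)) ->
  exists s : seq X, forall y, exists2 x, x \in s & U x y.
Proof.
move=> /compact_near_coveringP cX nU.
pose F := filter_from [set: seq X] (fun s => [set t : seq X | {subset s <= t}]).
have FF : Filter F.
  apply: filter_from_filter; first by exists [::].
  move=> s t _ _; exists (s ++ t) => // u /= sub; split => x xs; apply: sub;
    by rewrite mem_cat xs ?orbT.
have [s _ sP] : \forall s \near F,
    [set: X] `<=` (fun y => exists2 x, x \in s & U x y).
  apply: cX => x _; exists (U x, [set s | x \in s]); last first.
    by move=> [y s] [/= ? ?]; exists x.
  by split=> //=; exists [:: x] => // s; apply; rewrite inE.
by exists s => y; exact: (sP s (fun x => id) y I).
Qed.

(** Heine-Cantor for a continuous pseudometric D, such as the pullback of a metric along a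
    continuous map. *)
Lemma uniformly_near (X : topologicalType) (rho : metric_on R X)
    (D : X -> X -> R) (c : R) :
  compact [set: X] ->
  (forall x y, D x y = D y x) ->
  (forall y x z, D x z <= D x y + D y z) ->
  (forall x (e : R), 0 < e -> \forall y \near x, D x y < e) -> 0 < c ->
  exists2 delta, 0 < delta & forall x y, rho x y < delta -> D x y < c.
Proof.
move=> /compact_near_coveringP cX Ds Dt Dn c0.
have : \forall e \near (0:R)^'+, [set: X] `<=`
    (fun x => forall y, rho x y < e -> D x y < c).
  have c20 : 0 < c / 2 by rewrite divr_gt0.
  apply: cX => x _; have := Dn x _ c20.
  rewrite /prop_near1 (metric_nbhs rho) => -[r /= r0 hr].
  near=> x' e => y /= x'y.
  have xx' : rho x x' < r / 2.
    by near: x'; apply: metric_near; rewrite divr_gt0.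
  have er : e < r / 2 by near: e; apply: nbhs_right_lt; rewrite divr_gt0.
  have xy : rho x y < r by have := metric_triangle rho x' x y; lra.
  have /hr /= Dxx' : rho x x' < r by lra.
  have /hr /= Dxy := xy.
  by have := Dt x x' y; rewrite (Ds x' x); lra.
move=> [r /= r0 hr]; exists (r / 2); first by rewrite divr_gt0.
move=> x y; apply: (hr (r / 2)) => //=; last by rewrite divr_gt0.
by rewrite sub0r normrN gtr0_norm ?divr_gt0//; lra.
Unshelve. all: by end_near. Qed.

Definition cneg (X : topologicalType) (phi : continuousType X R) :
    continuousType X R := mkcts (fun x => cvgN (@cts_fun _ _ phi x)).

Lemma cnegE (X : topologicalType) (phi : continuousType X R) x :
  cneg phi x = - phi x.
Proof. by []. Qed.

Lemma ccstE (X : topologicalType) (l : R) x :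
  (cst l : continuousType X R) x = l.
Proof. by []. Qed.

Lemma gap_continuous (X : topologicalType) (rho : metric_on R X) (d : R) x :
  0 < d -> continuous (fun y => gap d (rho y x)).
Proof.
move=> d0; apply: (@lip_continuous _ rho _ (1 + d^-2)) => y z.
apply: (le_trans (gap_lip _ _ d0)); rewrite ler_wpM2l ?addr_ge0 ?invr_ge0//.
  by rewrite exprn_ge0// ltW.
by rewrite !(metric_sym rho _ x) metric_lip.
Qed.

Definition cgap (X : topologicalType) (rho : metric_on R X) (d : R) x
  (d0 : 0 < d) : continuousType X R := mkcts (@gap_continuous _ rho d x d0).

Lemma cgapE (X : topologicalType) (rho : metric_on R X) d x (d0 : 0 < d) y :
  cgap rho x d0 y = gap d (rho y x).
Proof. by []. Qed.

Section Convolution.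
Variables (X Y : topologicalType) (rho : metric_on R Y) (i : X -> Y).
Hypotheses (cX : compact [set: X]) (x0 : X).
Variables (d : R) (d0 : 0 < d).

(** chi y is the supremum of phi x - gap d (rho (i x) y), continuous because [gap d] is Lipschitz.
    The map i is the identity for [interpolation] and an isometric embedding for [lag_pull]. *)
Lemma sup_convolution (phi : continuousType X R) :
  exists chi : continuousType Y R,
    (forall x y, phi x <= chi y + gap d (rho (i x) y)) /\
    (forall y e, (forall x, phi x <= e + gap d (rho (i x) y)) -> chi y <= e).
Proof.
have [M hM] := continuous_bounded cX phi.
pose A y := range (fun x => phi x - gap d (rho (i x) y)).
have supA y : has_sup (A y).
  split; first by exists (phi x0 - gap d (rho (i x0) y)), x0.
  exists (M + d) => _ [x _ <-].
  have := gap_ge (rho (i x) y) d0; have := metric_ge0 rho (i x) y.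
  by have := le_trans (ler_norm _) (hM x); lra.
have up x y : phi x <= sup (A y) + gap d (rho (i x) y).
  by rewrite -lerBlDr; apply: sup_upper_bound; [exact: supA|exists x].
have low y e : (forall x, phi x <= e + gap d (rho (i x) y)) -> sup (A y) <= e.
  move=> h; apply: ge_sup; first exact: (supA y).1.
  by move=> _ [x _ <-]; rewrite lerBlDr.
have C0 : 0 <= 1 + d^-2 by rewrite addr_ge0// invr_ge0 exprn_ge0// ltW.
have lip y z : sup (A y) <= sup (A z) + (1 + d^-2) * rho y z.
  apply: low => x; apply: (le_trans (up x z)).
  have h1 := ler_wpM2l C0 (metric_lip rho (i x) z y).
  have h2 := le_trans (gap_lip (rho (i x) z) (rho (i x) y) d0) h1.
  have := le_trans (ler_norm _) h2; rewrite (metric_sym rho z y).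
  move: ((1 + _) * _) => t {h1 h2}; rewrite lerBlDr => h.
  by rewrite -addrA lerD2l.
have cA : continuous (fun y => sup (A y)).
  apply: (@lip_continuous _ rho _ (1 + d^-2)) => y z.
  by rewrite ler_distl lip lerBlDr metric_sym lip.
by exists (mkcts cA).
Qed.

Lemma inf_convolution (phi : continuousType X R) :
  exists chi : continuousType Y R,
    (forall x y, chi y <= phi x + gap d (rho (i x) y)) /\
    (forall y e, (forall x, e <= phi x + gap d (rho (i x) y)) -> e <= chi y).
Proof.
have [chi [up low]] := sup_convolution (cneg phi).
exists (cneg chi); split=> [x y|y e h].
  by have := up x y; rewrite !cnegE; lra.
have : chi y <= - e by apply: low => x; have := h x; rewrite !cnegE; lra.
by rewrite !cnegE; lra.
Qed.

End Convolution.
End MetricSpaces.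

(** * The metric on idempotent measures *)

Section Lag.
Variable R : realType.

(** On the empty space the constants 0 and 1 are the same function. *)
Lemma ispace_inhabited (X : topologicalType) (mu : ispace R X) : inhabited X.
Proof.
apply: contrapT => X0; have := mass_cst mu 0; have := mass_cst mu 1.
have -> : (cst 1 : continuousType X R) = (cst 0 : continuousType X R).
  by apply/continuousEP => x; exfalso; apply: X0.
by move=> -> /eqP; rewrite oner_eq0.
Qed.

Section Space.
Variables (X : topologicalType) (rho : metric_on R X).
Hypothesis cX : compact [set: X].
Implicit Types (mu nu la : ispace R X) (phi psi : continuousType X R) (d e : R).

(** If lambda_mu(x) <= lambda_nu(y) - gap d (rho x y), then admissible phi and psi satisfy
    lambda_mu(x) + phi(x) <= lambda_nu(y) + psi(y); this is the density condition tested on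
    functions. *)
Definition lag d mu nu := forall phi psi,
  (forall x y, phi x <= psi y + gap d (rho x y)) -> mass mu phi <= mass nu psi.

Lemma lag_le d e mu nu : 0 < d -> d <= e -> lag d mu nu -> lag e mu nu.
Proof.
move=> d0 de h phi psi hp; apply: h => x y; apply: (le_trans (hp x y)).
by rewrite lerD2l gap_anti.
Qed.

Lemma lag_refl d mu : 0 < d -> lag d mu mu.
Proof.
move=> d0 phi psi h; apply: mass_le => x; apply: (le_trans (h x x)).
by rewrite metric_xx gap_small ?ltW//; lra.
Qed.

(** The gap is never positive here, so the constant sup phi lies between phi and psi. *)
Lemma lag_bound d mu nu : 0 < d -> (forall x y, rho x y <= d) -> lag d mu nu.
Proof.
move=> d0 hd phi psi h; have [x0] := ispace_inhabited mu.
have [chi [up low]] := sup_convolution rho id cX x0 d0 phi.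
have le x y : phi x <= psi y.
  apply: (le_trans (h x y)); rewrite gap_small//.
  by have := hd x y; lra.
have [M hM] := continuous_bounded cX phi.
pose l := sup (range phi).
have sl : has_sup (range phi).
  split; first by exists (phi x0), x0.
  by exists M => _ [x _ <-]; exact: le_trans (ler_norm _) (hM x).
apply: (@le_trans _ _ l).
  rewrite -(mass_cst mu l); apply: mass_le => x.
  by apply: sup_upper_bound => //; exists x.
rewrite -(mass_cst nu l); apply: mass_le => y.
by apply: ge_sup; [exact: sl.1|move=> _ [x _ <-]; exact: le].
Qed.

(** chi is the sup-convolution of phi; its second bound is [gap_add] along the triangle inequality
    of rho. *)
Lemma interpolation d e phi psi : inhabited X -> 0 < d -> 0 < e ->
  (forall x y, phi x <= psi y + gap (d + e) (rho x y)) ->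
  exists chi : continuousType X R,
    (forall x y, phi x <= chi y + gap d (rho x y)) /\
    (forall x y, chi x <= psi y + gap e (rho x y)).
Proof.
move=> [x0] d0 e0 h; have [chi [up low]] := sup_convolution rho id cX x0 d0 phi.
exists chi; split=> // x y; apply: low => z.
have de0 : 0 < d + e by exact: addr_gt0.
have := gap_add (rho z x) (rho x y) d0 e0; have := h z y.
by have := gap_le de0 (metric_triangle rho x z y); lra.
Qed.

Lemma lag_trans d e mu nu la : 0 < d -> 0 < e ->
  lag d mu nu -> lag e nu la -> lag (d + e) mu la.
Proof.
move=> d0 e0 h1 h2 phi psi h.
have [chi [l1 l2]] := interpolation (ispace_inhabited mu) d0 e0 h.
by apply: (@le_trans _ _ (mass nu chi)); [exact: h1|exact: h2].
Qed.

Definition lag_set mu nu : set R :=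
  [set d | [/\ 0 < d, lag d mu nu & lag d nu mu]].

Definition lift_dist mu nu : R := inf (lag_set mu nu).

Lemma lag_set_lbound mu nu : has_lbound (lag_set mu nu).
Proof. by exists 0 => d [/ltW]. Qed.

Lemma lift_dist_le d mu nu : 0 < d -> lag d mu nu -> lag d nu mu ->
  lift_dist mu nu <= d.
Proof. by move=> *; apply: ge_inf => //; exact: lag_set_lbound. Qed.

Lemma lag_set_neq0 mu nu : lag_set mu nu !=set0.
Proof.
have [M hM] := rho_bounded cX rho; have [x0] := ispace_inhabited mu.
exists (M + 1); have M0 : 0 <= M by rewrite -(metric_xx rho x0).
have M1 : 0 < M + 1 by lra.
by split=> //; apply: lag_bound => // x y; have := hM x y; lra.
Qed.

Lemma lift_dist_ge0 mu nu : 0 <= lift_dist mu nu.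
Proof. by apply: lb_le_inf; [exact: lag_set_neq0|move=> d [/ltW]]. Qed.

Lemma lift_dist_lt d mu nu : lift_dist mu nu < d -> lag d mu nu /\ lag d nu mu.
Proof.
move=> /(inf_lt (lag_set_neq0 mu nu))[e [e0 h1 h2] ed].
by split; apply: lag_le (ltW ed) _.
Qed.

Lemma lift_dist_xx mu : lift_dist mu mu = 0.
Proof.
apply/eqP; rewrite eq_le lift_dist_ge0 andbT; apply/ler_addgt0Pr => e e0.
by rewrite add0r lift_dist_le//; exact: lag_refl.
Qed.

Lemma lift_dist_sym mu nu : lift_dist mu nu = lift_dist nu mu.
Proof.
by congr inf; apply/seteqP; split=> d [d0 h1 h2]; split.
Qed.

Lemma lift_dist_triangle nu mu la :
  lift_dist mu la <= lift_dist mu nu + lift_dist nu la.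
Proof.
apply/ler_addgt0Pr => e e0; have e20 : 0 < e / 2 by rewrite divr_gt0.
pose d1 := lift_dist mu nu + e / 2; pose d2 := lift_dist nu la + e / 2.
have d10 : 0 < d1 by rewrite ltr_wpDl ?lift_dist_ge0.
have d20 : 0 < d2 by rewrite ltr_wpDl ?lift_dist_ge0.
have [h1 h2] : lag d1 mu nu /\ lag d1 nu mu by apply: lift_dist_lt; rewrite ltrDl.
have [h3 h4] : lag d2 nu la /\ lag d2 la nu by apply: lift_dist_lt; rewrite ltrDl.
have -> : lift_dist mu nu + lift_dist nu la + e = d1 + d2 by rewrite /d1 /d2; lra.
apply: lift_dist_le; first exact: addr_gt0.
  exact: lag_trans h1 h3.
by rewrite addrC; exact: lag_trans h4 h2.
Qed.

(** The pair phi, phi + e is admissible for small d: by uniform continuity at near points, and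
    because the gap exceeds the oscillation of phi at far ones. *)
Lemma lag_small phi e : 0 < e -> exists2 d, 0 < d &
  forall mu nu, lag d mu nu -> mass mu phi <= mass nu phi + e.
Proof.
move=> e0; have e20 : 0 < e / 2 by rewrite divr_gt0.
have [eta eta0 unif] : exists2 eta, 0 < eta &
    forall x y, rho x y < eta -> `|phi x - phi y| < e / 2.
  apply: (@uniformly_near _ _ _ (fun x y => `|phi x - phi y|)) => //.
  - by move=> x y; rewrite distrC.
  - by move=> x y z; exact: ler_distD.
  - by move=> x c c0; have /cvgrPdist_lt := @cts_fun _ _ phi x; exact.
have [M hM] := continuous_bounded cX phi.
have [d0 d00 big] := gap_cvgy (M + M) eta0.
pose d := Num.min d0 (e / 2); exists d; first by rewrite lt_min d00.
have dp : 0 < d by rewrite lt_min d00.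
move=> mu nu h; rewrite -mass_otimes; apply: h => x y; rewrite otimesE.
have [xy|xy] := ltP (rho x y) eta.
  have := le_trans (ler_norm _) (ltW (unif _ _ xy)).
  have := gap_ge (rho x y) dp; have := metric_ge0 rho x y.
  have : d <= e / 2 by rewrite ge_min lexx orbT.
  by lra.
have := big d _ dp _ xy; rewrite ge_min lexx => /(_ isT).
have := le_trans (ler_norm _) (hM x).
have := hM y; rewrite ler_norml => /andP[].
by lra.
Qed.

(** Closeness on finitely many functions suffices: the negated gaps with parameter d / 2 at the
    points of a d / 4-net. The maximum g of their translates by chi x replaces psi. *)
Lemma lag_near mu d : 0 < d ->
  \forall nu \near mu, lag d mu nu /\ lag d nu mu.
Proof.
move=> d0; have d20 : 0 < d / 2 by rewrite divr_gt0.
have d40 : 0 < d / 4 by rewrite divr_gt0.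
have [s sP] := @compact_finite_cover X (fun x y => rho x y < d / 4) cX
  (fun x => metric_near rho x d40).
pose c x := cneg (cgap rho x d20).
have near_s : \forall nu \near mu, forall x, x \in s ->
    `|mass mu (c x) - mass nu (c x)| < d / 2.
  elim: s {sP} => [|x s IH]; first by
    apply: (@filterS _ (nbhs mu) _ setT) filterT => nu _ x; rewrite in_nil.
  have /cvgrPdist_lt /(_ _ d20) hx := @mass_continuous R X (c x) mu.
  apply: filterS2 hx IH => nu hx hs y; rewrite inE => /orP[/eqP ->//|]; exact: hs.
have key la nu : (forall x, x \in s -> `|mass la (c x) - mass nu (c x)| < d / 2) ->
    lag d la nu.
  move=> hs phi psi h.
  have [chi [l1 l2]] : exists chi : continuousType X R,
    (forall x y, phi x <= chi y + gap (d / 2) (rho x y)) /\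
    (forall x y, chi x <= psi y + gap (d / 2) (rho x y)).
    apply: interpolation => //; first exact: ispace_inhabited la.
    by move=> x y; rewrite -splitr.
  have sub x : mass nu (c x) + chi x <= mass nu psi.
    rewrite -mass_otimes; apply: mass_le => y; rewrite otimesE cnegE cgapE.
    by have := l2 x y; rewrite (metric_sym rho x y); lra.
  have [g [gle gge]] : exists g : continuousType X R, mass la g <= mass nu psi + d / 2 /\
      forall x, x \in s -> forall y, otimes (chi x) (c x) y <= g y.
    elim: s hs {sP near_s} => [|x s IH] hs.
      by exists (cst (mass nu psi + d / 2)); split=> //; rewrite mass_cst.
    have [|g [g1 g2]] := IH; first by move=> y ys; apply: hs; rewrite inE ys orbT.
    exists (oplus (otimes (chi x) (c x)) g); split.
      rewrite mass_oplus ge_max g1 andbT mass_otimes.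
      have := hs x; rewrite inE eqxx => /(_ isT) /ltW /(le_trans (ler_norm _)).
      by have := sub x; lra.
    move=> z; rewrite inE => /orP[/eqP ->|zs] y; rewrite oplusE le_max ?lexx//.
    by rewrite g2 ?orbT.
  (* At a net point x with r = rho y x < d / 4, phi y + d / 2 <= chi x + r <= chi x + d / 2 - r,
     which is chi x + c x y. The gain d / 2 pays for the error in the mass of g. *)
  suff : mass la (otimes (d / 2) phi) <= mass la g by rewrite mass_otimes; lra.
  apply: mass_le => y; have [x xs xy] := sP y.
  apply: le_trans (gge x xs y); rewrite !otimesE cnegE cgapE.
  have := l1 y x; rewrite (metric_sym rho y x) gap_small; last by lra.
  by lra.
apply: filterS near_s => nu h; split; apply: key => // x xs.
by rewrite distrC h.
Qed.

Lemma lift_dist_eq0 mu nu : lift_dist mu nu = 0 -> mu = nu.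
Proof.
move=> h0; apply: mass_inj => phi; apply/eqP; rewrite eq_le.
by apply/andP; split; apply/ler_addgt0Pr => e /(lag_small phi)[d d0 hd];
  apply: hd; have [] := @lift_dist_lt d mu nu; rewrite ?h0.
Qed.

Lemma lift_dist_nbhs mu : nbhs mu =
  filter_from [set e : R | 0 < e] (fun e => [set nu | lift_dist mu nu < e]).
Proof.
apply/seteqP; split=> [U Umu|U [e /= e0 eU]].
  set F := filter_from _ _.
  have FF : Filter F.
    apply: filter_from_filter; first by exists 1 => /=.
    move=> a b /= a0 b0; exists (Num.min a b); first by rewrite /= lt_min a0.
    by move=> nu /=; rewrite lt_min => /andP[].
  suff cF : F --> mu by exact: cF.
  apply: mass_cvg => phi; apply/cvgrPdist_le => e e0.
  have [d d0 hd] := lag_small phi e0; exists d => // nu /= /lift_dist_lt[h1 h2].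
  by rewrite ler_distl lerBlDr !hd.
have e20 : 0 < e / 2 by rewrite divr_gt0.
apply: filterS (lag_near mu e20) => nu [h1 h2]; apply: eU => /=.
by apply: le_lt_trans (lift_dist_le e20 h1 h2) _; lra.
Qed.

Definition lift_metric : metric_on R (ispace R X) :=
  MetricOn lift_dist_xx lift_dist_eq0 lift_dist_sym lift_dist_triangle
    lift_dist_nbhs.

End Space.
End Lag.

(** * Isometric embeddings and moduli of continuity under I *)

Section Functor.
Variable R : realType.

Section Maps.
Variables (X Y : topologicalType) (rhoX : metric_on R X) (rhoY : metric_on R Y).
Variable f : continuousType X Y.

Lemma lag_push d e (mu nu : ispace R X) :
  (forall x y, gap e (rhoY (f x) (f y)) <= gap d (rhoX x y)) ->
  lag rhoX d mu nu -> lag rhoY e (imap R f mu) (imap R f nu).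
Proof.
move=> fde h phi psi hp.
apply: (h (phi \o f : continuousType X R) (psi \o f : continuousType X R)).
by move=> x y /=; apply: (le_trans (hp (f x) (f y))); rewrite lerD2l.
Qed.

Hypotheses (cX : compact [set: X]) (cY : compact [set: Y]).

(** Test functions on X are carried to Y by sup- and inf-convolution with parameter e. Each costs e
    in the lag, and gap e 0 = -e <= 0 keeps the right order on the image of f. *)
Lemma lag_pull d e (mu nu : ispace R X) : isometric rhoX rhoY f ->
  0 < d -> 0 < e -> lag rhoY d (imap R f mu) (imap R f nu) ->
  lag rhoX (e + (d + e)) mu nu.
Proof.
move=> iso d0 e0 h phi psi hp; have [x0] := ispace_inhabited mu.
have [chi [cup clow]] := sup_convolution rhoY f cX x0 e0 phi.
have [om [oup olow]] := inf_convolution rhoY f cX x0 e0 psi.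
have gap0 x : gap e (rhoY (f x) (f x)) = - e.
  by rewrite metric_xx gap_small ?ltW// sub0r.
apply: (@le_trans _ _ (mass mu (chi \o f : continuousType X R))).
  by apply: mass_le => x /=; have := cup x (f x); rewrite gap0; lra.
apply: (@le_trans _ _ (mass nu (om \o f : continuousType X R))); last first.
  by apply: mass_le => x /=; have := oup x (f x); rewrite gap0; lra.
apply: h => y z; apply: clow => x; rewrite -lerBlDr -lerBlDr; apply: olow => w.
have de0 : 0 < d + e by rewrite addr_gt0.
have g1 := gap_add (rhoY (f x) y) (rhoY y z + rhoY z (f w)) e0 de0.
have g2 := gap_add (rhoY y z) (rhoY z (f w)) d0 e0.
have g3 : gap (e + (d + e)) (rhoX x w) <=
    gap (e + (d + e)) (rhoY (f x) y + (rhoY y z + rhoY z (f w))).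
  apply: gap_le; first by rewrite addr_gt0.
  rewrite -iso; have := metric_triangle rhoY y (f x) (f w).
  by have := metric_triangle rhoY z y (f w); lra.
by have := hp x w; rewrite (metric_sym rhoY (f w) z); lra.
Qed.

Lemma lift_isometric : isometric rhoX rhoY f ->
  isometric (lift_metric rhoX cX) (lift_metric rhoY cY) (imap R f).
Proof.
move=> iso mu nu /=; apply/eqP; rewrite eq_le; apply/andP; split;
  apply/ler_addgt0Pr => e e0.
  have e1 : 0 < lift_dist rhoX mu nu + e by rewrite ltr_wpDl ?lift_dist_ge0.
  have [|h1 h2] := @lift_dist_lt _ _ rhoX cX (lift_dist rhoX mu nu + e) mu nu.
    by rewrite ltrDl.
  by apply: lift_dist_le => //; [apply: lag_push h1|apply: lag_push h2] => x y;
    rewrite iso.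
have e30 : 0 < e / 3 by rewrite divr_gt0.
set d := lift_dist rhoY _ _.
have d0 : 0 < d + e / 3 by rewrite ltr_wpDl ?lift_dist_ge0.
have [|h1 h2] := @lift_dist_lt _ _ rhoY cY (d + e / 3) (imap R f mu) (imap R f nu).
  by rewrite ltrDl.
(* One third of e exceeds the infimum, the other two are lost in [lag_pull]. *)
have -> : d + e = e / 3 + (d + e / 3 + e / 3) by lra.
have l0 : 0 < e / 3 + (d + e / 3 + e / 3) by rewrite addr_gt0// addr_gt0.
by apply: lift_dist_le => //; apply: lag_pull.
Qed.

(** By [gap_dilate], [lag_push] takes lag d to lag c + dilate eta d. *)
Lemma lift_modulus c eta : 0 <= c -> 0 < eta -> eta <= 1 ->
  (forall x y, rhoY (f x) (f y) <= c + dilate eta (rhoX x y)) ->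
  forall mu nu, lift_dist rhoY (imap R f mu) (imap R f nu) <=
    c + dilate eta (lift_dist rhoX mu nu).
Proof.
move=> c0 eta0 eta1 hf mu nu; apply/ler_addgt0Pr => e e0.
set d := lift_dist rhoX mu nu.
have K0 : 0 < eta^-2 by rewrite invr_gt0 exprn_gt0.
(* The slope of [dilate eta] is at most eta^-2, so the excess e' costs at most e. *)
pose e' := e * eta ^+ 2; have e'0 : 0 < e' by rewrite mulr_gt0 ?exprn_gt0.
have d0 : 0 < d + e' by rewrite ltr_wpDl ?lift_dist_ge0.
have le_d : d <= d + e' by rewrite lerDl ltW.
have /andP[b1 b2] := dilateB eta0 eta1 le_d.
have e'K : eta^-2 * e' = e by rewrite /e' mulrC mulfK// expf_neq0// lt0r_neq0.
apply: (@le_trans _ _ (c + dilate eta (d + e'))); last first.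
  by move: b2; rewrite (addrC d) addrK e'K; lra.
have [|h1 h2] := @lift_dist_lt _ _ rhoX cX (d + e') mu nu; first by rewrite ltrDl.
have cd0 : 0 < c + dilate eta (d + e').
  by have /andP[] := dilate_bounds eta0 eta1 (ltW d0); lra.
apply: lift_dist_le => //; [apply: lag_push h1|apply: lag_push h2] => x y;
  by apply: le_trans (gap_dilate eta0 eta1 _ c0 d0); apply: gap_le.
Qed.

End Maps.

(** * Distance to Dirac measures, and points of maximal density *)

Section Points.
Variables (X : topologicalType) (rho : metric_on R X).
Hypothesis cX : compact [set: X].
Implicit Types (mu nu : ispace R X).

Lemma mass_dirac (x : X) (phi : continuousType X R) :
  mass (dirac R x) phi = phi x.
Proof. by []. Qed.

Lemma lift_dist_dirac x y : lift_dist rho (dirac R x) (dirac R y) = rho x y.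
Proof.
have close u v d : 0 < d -> rho u v <= d -> lag rho d (dirac R u) (dirac R v).
  move=> d0 uvd phi psi h; apply: (le_trans (h u v)).
  by rewrite gap_small// gerDl subr_le0.
apply/eqP; rewrite eq_le; apply/andP; split; apply/ler_addgt0Pr => e e0.
  have d0 : 0 < rho x y + e by rewrite ltr_wpDl ?metric_ge0.
  by apply: lift_dist_le => //; apply: close => //; rewrite ?(metric_sym rho y) lerDl ltW.
have e20 : 0 < e / 2 by rewrite divr_gt0.
pose d := lift_dist rho (dirac R x) (dirac R y) + e / 2.
have d0 : 0 < d by rewrite ltr_wpDl ?lift_dist_ge0.
have de0 : 0 < d + e / 2 by rewrite addr_gt0.
have [|h _] := @lift_dist_lt _ _ rho cX d (dirac R x) (dirac R y).
  by rewrite ltrDl.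
(* The left side is e / 2 > 0, so the gap at y on the right is negative and bounds rho y x. *)
have : cneg (cgap rho x e20) x <= cneg (cgap rho x de0) y.
  apply: h => u v; rewrite !cnegE !cgapE.
  have := gap_add (rho u v) (rho u x) d0 e20.
  have := gap_le de0 (metric_triangle rho u v x).
  by rewrite (metric_sym rho v u); lra.
rewrite !cnegE !cgapE metric_xx gap_small; last exact: ltW.
move=> le; have : gap (d + e / 2) (rho y x) < 0 by lra.
by move=> /(gap_lt0 de0); rewrite metric_sym /d; lra.
Qed.

(** For d between the distance and s, [lag d] compares the gap with parameter s to the one with
    parameter s - d, which is negative at z. *)
Lemma mass_gap_lt0 (s : R) (s0 : 0 < s) mu z :
  lift_dist rho mu (dirac R z) < s -> mass mu (cgap rho z s0) < 0.
Proof.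
move=> ds; set t := lift_dist _ _ _ in ds.
have t0 : 0 <= t by exact: lift_dist_ge0.
pose d := (t + s) / 2; pose e := s - d.
have d0 : 0 < d by rewrite /d; lra.
have e0 : 0 < e by rewrite /e /d; lra.
have [|h _] := @lift_dist_lt _ _ rho cX d mu (dirac R z); first by rewrite -/t /d; lra.
apply: (@le_lt_trans _ _ (cgap rho z e0 z)); last first.
  by rewrite cgapE metric_xx gap_small ?ltW//; lra.
apply: h => x y; rewrite !cgapE.
have := gap_add (rho x y) (rho y z) d0 e0.
have -> : d + e = s by rewrite /e; lra.
by have := gap_le s0 (metric_triangle rho y x z); lra.
Qed.

Lemma lift_dist_dirac_le (s : R) (s0 : 0 < s) mu z :
  mass mu (cgap rho z s0) < 0 -> lift_dist rho mu (dirac R z) <= s.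
Proof.
move=> neg; apply: lift_dist_le => // phi psi h.
  apply: (@le_trans _ _ (mass mu (otimes (psi z) (cgap rho z s0)))).
    by apply: mass_le => x; rewrite otimesE cgapE addrC.
  by rewrite mass_otimes mass_dirac; lra.
(* Admissibility makes this maximum nonnegative everywhere; as the gap has negative mass, psi - phi
   z must have nonnegative mass. *)
have : 0 <= mass mu (oplus (cgap rho z s0) (otimes (- phi z) psi)).
  rewrite -(mass_cst mu 0); apply: mass_le => y.
  rewrite oplusE otimesE cgapE le_max /cst /=.
  have := h z y; rewrite (metric_sym rho z y) => hy.
  by have [//|lt] := leP 0 (gap s (rho y z)); rewrite ccstE; lra.
by rewrite mass_oplus le_max mass_otimes leNgt neg /= subr_ge0.
Qed.

(** Otherwise the gap with parameter t - h / 2 has negative mass for some h > 0, and the distance t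
    would be at most t - h / 2. That gap is at most -h / 2 within t - h of z, and at most gap s -
    gap s (t - h) beyond. *)
Lemma gap_le_mass (s : R) (s0 : 0 < s) mu z : s < lift_dist rho mu (dirac R z) ->
  gap s (lift_dist rho mu (dirac R z)) <= mass mu (cgap rho z s0).
Proof.
set t := lift_dist _ _ _ => st; rewrite leNgt; apply/negP => lt.
set v := mass _ _ in lt.
pose C := 1 + s^-2; have C0 : 0 < C.
  by rewrite ltr_wpDr// invr_ge0 exprn_ge0// ltW.
pose w := (gap s t - v) / 2.
have w0 : 0 < w by rewrite divr_gt0// subr_gt0.
(* The first bound keeps s <= t - h; the second, with the Lipschitz constant C, keeps gap s (t - h)
   above v. *)
pose h : R := Num.min (t - s) (w / C).
have h0 : 0 < h by rewrite lt_min subr_gt0 st divr_gt0.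
have hC : C * h <= w.
  by rewrite mulrC -ler_pdivlMr// ge_min lexx orbT.
have hs : s <= t - h by rewrite lerBrDl -lerBrDr ge_min lexx.
have big : v < gap s (t - h).
  have := gap_lip t (t - h) s0; rewrite (_ : t - (t - h) = h); last by lra.
  rewrite (gtr0_norm h0) -/C => /(le_trans (ler_norm _)); move: hC.
  by rewrite /w; move: (C * h) => q; lra.
have r0 : 0 < t - h / 2 by lra.
have : mass mu (cgap rho z r0) < 0.
  apply: (@le_lt_trans _ _ (mass mu (oplus (otimes (- gap s (t - h)) (cgap rho z s0))
      (cst (- (h / 2)))))).
    apply: mass_le => x; rewrite oplusE otimesE !cgapE le_max ccstE.
    have [rt|tr] := leP (rho x z) (t - h).
      by apply/orP; right; rewrite gap_small; lra.
    apply/orP; left; apply: (@le_trans _ _ (gap (t - h) (rho x z))).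
      by apply: gap_anti; lra.
    by rewrite !gap_large//; lra.
  by rewrite mass_oplus mass_otimes mass_cst gt_max -/v; clearbody h; apply/andP; split; lra.
by move=> /lift_dist_dirac_le; rewrite -/t; lra.
Qed.

(** x is a point of density 0. Without one, each x has a function of mass 0 that is positive near x;
    the maximum of finitely many has mass at most 0 but a positive lower bound. *)
Lemma mass_peak mu : exists x, forall phi : continuousType X R, phi x <= mass mu phi.
Proof.
apply: contrapT => /forallNP no.
have /choice[g gP] x : exists phi : continuousType X R, mass mu phi < phi x.
  by have /existsNP[phi /negP] := no x; rewrite -ltNge => ?; exists phi.
pose w x := (g x x - mass mu (g x)) / 2.
have w0 x : 0 < w x by rewrite divr_gt0// subr_gt0.
pose U x := [set y | mass mu (g x) + w x <= g x y].
have nU x : nbhs x (U x).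
  have /cvgrPdist_lt /(_ _ (w0 x)) := @cts_fun _ _ (g x) x; apply: filterS => y.
  by rewrite ltr_norml /U /w /= => /andP[_]; lra.
have [s sP] := compact_finite_cover cX nU.
have [e e0 [h [h1 h2]]] : exists2 e : R, 0 < e & exists h : continuousType X R,
    mass mu h <= 0 /\ forall x, x \in s -> forall y, U x y -> e <= h y.
  elim: s {sP} => [|x s [e e0 [h [h1 h2]]]].
    by exists 1 => //; exists (cst 0); rewrite mass_cst.
  exists (Num.min (w x) e); first by rewrite lt_min w0.
  exists (oplus (otimes (- mass mu (g x)) (g x)) h); split.
    by rewrite mass_oplus mass_otimes subrr ge_max lexx.
  move=> z; rewrite inE => zs y Uy; rewrite oplusE otimesE ge_min !le_max.
  case/orP: zs => [/eqP zx|zs]; last by rewrite (h2 z zs y Uy) !orbT.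
  by apply/orP; left; apply/orP; left; move: Uy; rewrite zx /U/=; lra.
have : e <= mass mu h.
  rewrite -(mass_cst mu e); apply: mass_le => y.
  by have [x xs Uy] := sP y; exact: h2 xs y Uy.
by lra.
Qed.

End Points.
End Functor.

(** * Diameters *)

Section Diameter.
Variables (R : realType) (X : topologicalType) (rho : metric_on R X).

(** 0 <= M serves the empty space, where the supremum is 0. *)
Lemma diam_le (M : R) : 0 <= M -> (forall x y, rho x y <= M) -> diam rho <= M.
Proof.
move=> M0 hM; rewrite /diam; set A := [set _ | _ in _].
have [->|/set0P A0] := eqVneq A set0; first by rewrite sup0.
by apply: ge_sup => // _ [[x y] _ <-]; exact: hM.
Qed.

Lemma le_diam x y : compact [set: X] -> rho x y <= diam rho.
Proof.
move=> cX; have [M hM] := rho_bounded cX rho.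
apply: sup_upper_bound; last by exists (x, y).
split; first by exists (rho x y), (x, y).
by exists M => _ [[u v] _ <-]; exact: hM.
Qed.

Lemma diam_ge0 : compact [set: X] -> 0 <= diam rho.
Proof.
move=> cX; rewrite /diam; set A := [set _ | _ in _].
have [->|/set0P[_ [[x y] _ _]]] := eqVneq A set0; first by rewrite sup0.
by rewrite -(metric_xx rho x); exact: le_diam.
Qed.

End Diameter.

(** * Compatibility of the metric with the multiplication and the unit *)

Section Monad.
Variables (R : realType) (X : topologicalType) (rho : metric_on R X).
Hypothesis cX : compact [set: X].
Let cIX := ispace_compact (R := R) cX.
Let rhoI := lift_metric rho cX.
Implicit Types (M N : ispace R (ispace R X)) (mu nu : ispace R X).

Lemma barE mu (phi : continuousType X R) : bar phi mu = mass mu phi.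
Proof. by []. Qed.

Lemma diam_lift : diam rhoI = diam rho.
Proof.
apply/eqP; rewrite eq_le; apply/andP; split.
  apply: diam_le => [|mu nu]; first exact: diam_ge0.
  apply/ler_addgt0Pr => e e0.
  have d0 : 0 < diam rho + e by rewrite ltr_wpDl ?diam_ge0.
  have hd x y : rho x y <= diam rho + e.
    by apply: (le_trans (le_diam rho x y cX)); rewrite lerDl ltW.
  by apply: lift_dist_le => //; apply: lag_bound.
apply: diam_le => [|x y]; first exact: diam_ge0.
by rewrite -(lift_dist_dirac rho cX x y); exact: (le_diam rhoI).
Qed.

(** For s just above the distance of mu and nu, [gap_comp] makes phi, psi + gap d s admissible for
    lag s; hence [bar phi], [bar psi] are admissible for lag d. *)
Lemma lag_mult (d : R) M N : 0 < d -> lag rhoI d M N -> lag rho d (ipsi R X M) (ipsi R X N).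
Proof.
move=> d0 h phi psi hp; apply: (h (bar phi) (bar psi)) => mu nu.
apply/ler_addgt0Pr => e e0; set t := rhoI mu nu.
pose C := 1 + d^-2; have C0 : 0 < C.
  by rewrite ltr_wpDr// invr_ge0 exprn_ge0// ltW.
(* C is a Lipschitz constant of [gap d], so the excess e / C raises it by at most e. *)
pose s := t + e / C; have eC0 : 0 < e / C by rewrite divr_gt0.
have s0 : 0 < s by rewrite ltr_wpDl ?lift_dist_ge0.
have [|hs _] := @lift_dist_lt _ _ rho cX s mu nu; first by rewrite ltrDl.
have : mass mu phi <= mass nu (otimes (gap d s) psi).
  apply: hs => x y; rewrite otimesE; apply: (le_trans (hp x y)).
  by rewrite -addrA lerD2l gap_comp.
have : gap d s <= gap d t + e.
  have := gap_lip s t d0; rewrite -/C (_ : s - t = e / C); last by rewrite /s; lra.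
  by rewrite (gtr0_norm eC0) mulrC divfK ?lt0r_neq0// => /(le_trans (ler_norm _)); lra.
by rewrite mass_otimes !barE; lra.
Qed.

Lemma mult_nonexpanding M N :
  lift_dist rho (ipsi R X M) (ipsi R X N) <= lift_dist rhoI M N.
Proof.
apply/ler_addgt0Pr => e e0.
have d0 : 0 < lift_dist rhoI M N + e.
  by rewrite ltr_wpDl//; exact: (lift_dist_ge0 rhoI).
have [|h1 h2] := @lift_dist_lt _ _ rhoI cIX (lift_dist rhoI M N + e) M N.
  by rewrite ltrDl.
by apply: lift_dist_le => //; exact: lag_mult.
Qed.

Lemma mult_dirac mu : ipsi R X (dirac R mu) = mu.
Proof. exact: mass_inj. Qed.

(** One inequality is [mult_nonexpanding]. For the other, [gap_le_mass] bounds the gap of the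
    distance from nu to the Dirac measure by the nu-mass of the gap on X, so negativity of the
    latter under psi(M) passes to M. *)
Lemma lift_dist_mult_dirac M z :
  lift_dist rho (ipsi R X M) (dirac R z) =
  lift_dist rhoI M (dirac R (dirac R z)).
Proof.
apply/eqP; rewrite eq_le; apply/andP; split.
  by rewrite -[X in lift_dist _ _ X]mult_dirac mult_nonexpanding.
apply/ler_addgt0Pr => e e0; set a := ipsi R X M; set t := lift_dist rho a _.
have t0 : 0 <= t by exact: lift_dist_ge0.
pose s := t + e / 2; pose s' := t + e.
have s0 : 0 < s by rewrite /s; lra.
have s'0 : 0 < s' by rewrite /s'; lra.
have neg : mass a (cgap rho z s0) < 0.
  by apply: (mass_gap_lt0 cX); rewrite -/t /s; lra.
apply: (lift_dist_dirac_le (s0 := s'0)).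
apply: (@le_lt_trans _ _ (mass M (oplus (bar (cgap rho z s0)) (cst (- (e / 2)))))).
  apply: mass_le => nu; rewrite oplusE cgapE le_max; apply/orP.
  have [rs|sr] := leP (lift_dist rho nu (dirac R z)) s.
    by right; rewrite ccstE gap_small; move: rs; rewrite /s' /s; lra.
  left; rewrite barE; apply: le_trans (gap_le_mass s0 sr).
  by apply: gap_anti => //; rewrite /s /s'; lra.
by rewrite mass_oplus mass_cst gt_max neg/=; lra.
Qed.

(** A point z of density 0 of mu is at least as close to x as mu is to the Dirac measure at x, so a
    is no farther from the Dirac measure at z than its image is from the one at mu. *)
Lemma lift_distance_point (a mu : ispace R X) (eps : R) :
  (forall z, eps <= lift_dist rho a (dirac R z)) ->
  eps <= lift_dist rhoI (imap R (ieta R X) a) (dirac R mu).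
Proof.
move=> ha; have [z hz] := mass_peak cX mu.
have far x : rho x z <= lift_dist rho (dirac R x) mu.
  apply/ler_addgt0Pr => e e0; set t := lift_dist _ _ _.
  have s0 : 0 < t + e by rewrite ltr_wpDl ?lift_dist_ge0.
  have : mass mu (cgap rho x s0) < 0.
    by apply: (mass_gap_lt0 cX); rewrite lift_dist_sym -/t; lra.
  move=> /(le_lt_trans (hz _)); rewrite cgapE => /(gap_lt0 s0).
  by rewrite metric_sym => /ltW.
apply/ler_addgt0Pr => e e0; set t := lift_dist _ _ _.
have s0 : 0 < t + e by rewrite ltr_wpDl//; exact: (lift_dist_ge0 rhoI).
apply: (le_trans (ha z)); apply: (lift_dist_dirac_le (s0 := s0)).
have : mass (imap R (ieta R X) a) (cgap rhoI mu s0) < 0.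
  by apply: (mass_gap_lt0 cIX); rewrite -/t; lra.
apply: le_lt_trans; apply: mass_le => x; rewrite cgapE /=.
by apply: gap_le.
Qed.

End Monad.

(** * Representatives in the direct limit *)

Section Stages.
Variables (R : realType) (F : endofunctor R) (eta : nat_trans (id_functor R) F).

Lemma plus_stages (X : compactum R) (P : plus_obj eta X) :
  exists n, forall m, (n <= m)%N -> exists a : iter_obj F m X, P = in_plus eta a.
Proof.
have [n [a Pa]] : exists n (a : iter_obj F n X), P = in_plus eta a.
  exists (tag (repr P)), (tagged (repr P)).
  by rewrite /in_plus -[LHS]reprK; case: (repr P).
exists n => m /subnK <-; elim: (m - n)%N => [|k [b ->]]; first by exists a.
exists (eta (iter_obj F (k + n) X) b : iter_obj F (k.+1 + n) X).
by apply/in_plusP; exists 1%N, 0%N.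
Qed.

Lemma plus_common_stage (X : compactum R) (P Q : plus_obj eta X) :
  exists n (a b : iter_obj F n X), P = in_plus eta a /\ Q = in_plus eta b.
Proof.
have [n hP] := plus_stages P; have [m hQ] := plus_stages Q.
have [a Pa] := hP _ (leq_addr m n); have [b Qb] := hQ _ (leq_addl n m).
by exists (n + m)%N, a, b.
Qed.

End Stages.

(** * Uniform continuity on the direct limit, and the theorem *)

Section Main.
Variable R : realType.

Definition idem_lift : metric_lift (idem_functor R) :=
  fun X rho => lift_metric rho (@compactum_compact R X).

(** The same c and eta serve every n; this uniformity gives (P4). *)
Lemma iter_modulus (X Y : compactum R) (rhoX : metric_on R X)
    (rhoY : metric_on R Y) (f : continuousType X Y) (c eta : R) :
  0 <= c -> 0 < eta -> eta <= 1 ->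
  (forall x y, rhoY (f x) (f y) <= c + dilate eta (rhoX x y)) ->
  forall n a b, iter_metric idem_lift n rhoY 
    (iter_map (idem_functor R) n f a) (iter_map (idem_functor R) n f b) <=
    c + dilate eta (iter_metric idem_lift n rhoX a b).
Proof.
move=> c0 eta0 eta1 hf; elim=> [|n IH] a b; first exact: hf.
exact: (lift_modulus (@compactum_compact R _) c0 eta0 eta1 IH).
Qed.

(** The constant c covers pairs at distance below delta; for the others eta is so small that the
    dilation exceeds the diameter of Y. *)
Lemma continuous_modulus (X Y : compactum R) (rhoX : metric_on R X)
    (rhoY : metric_on R Y) (f : continuousType X Y) (c : R) : 0 < c ->
  exists2 eta, 0 < eta <= 1 &
    forall x y, rhoY (f x) (f y) <= c + dilate eta (rhoX x y).
Proof.
move=> c0.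
have [delta delta0 unif] : exists2 delta, 0 < delta &
    forall x y, rhoX x y < delta -> rhoY (f x) (f y) < c.
  apply: (@uniformly_near _ _ _ (fun x y => rhoY (f x) (f y))) => //.
  - exact: compactum_compact.
  - by move=> x y; rewrite metric_sym.
  - by move=> y x z; exact: metric_triangle.
  - by move=> x e e0; exact: (@cts_fun _ _ f x _ (metric_near rhoY (f x) e0)).
have [eta /andP[eta0 eta1] far] := dilate_large (diam rhoY) delta0.
exists eta; first by rewrite eta0.
move=> x y; have [xy|xy] := ltP (rhoX x y) delta.
  apply: (le_trans (ltW (unif _ _ xy))); rewrite lerDl.
  have xy0 := metric_ge0 rhoX x y.
  by have /andP[+ _] := dilate_bounds eta0 eta1 xy0; exact: le_trans.
apply: (le_trans (le_diam rhoY _ _ (@compactum_compact R Y))).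
by have := far _ xy; lra.
Qed.

End Main.

Theorem theorem1 (R : realType) :
  perfectly_metrizable (idem_unit R) (idem_mult R).
Proof.
exists (@idem_lift R).
have iso_unit (X : compactum R) (rho : metric_on R X) :
    isometric rho (idem_lift rho) (idem_unit R X).
  by move=> x y; exact: (lift_dist_dirac rho (@compactum_compact R X)).
split=> //.
- by move=> X1 X2 rho1 rho2 i iso; exact: lift_isometric.
- by move=> X rho; exact: diam_lift.
- move=> X1 X2 rho1 rho2 f e e0; have e20 : 0 < e / 2 by rewrite divr_gt0.
  have [eta /andP[eta0 eta1] hf] := continuous_modulus rho1 rho2 f e20.
  have K0 : 0 < eta ^+ 2 by rewrite exprn_gt0.
  (* The slope bound eta^-2 of [dilate eta] turns this into e / 2. *)
  exists (e / 2 * eta ^+ 2) => [|P Q]; first by rewrite mulr_gt0.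
  have [n [a [b [-> ->]]]] := plus_common_stage P Q.
  rewrite !plus_mapE !plus_distE// => ab.
  apply: (le_lt_trans (iter_modulus (ltW e20) eta0 eta1 hf a b)).
  have /andP[_ h] := dilate_bounds eta0 eta1
    (metric_ge0 (iter_metric (@idem_lift R) n rho1) a b).
  rewrite [ltRHS]splitr ltrD2l; apply: (le_lt_trans h).
  by rewrite mulrC ltr_pdivrMr.
- by move=> X rho M N; exact: mult_nonexpanding.
- by move=> X rho a x0 b <-; exact: lift_dist_mult_dirac.
- move=> X rho a e he; apply: lb_le_inf.
    by eexists; exists (ieta R (ispace R X) a).
  move=> _ [_ [mu _ <-] <-]; apply: lift_distance_point => z.
  apply: (le_trans he); apply: ge_inf; last by exists (dirac R z) => //; exists z.
  by exists 0 => _ [y _ <-]; exact: metric_ge0.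
Qed.
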